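(* Fix $\varepsilon\in(1/2,1)$ and $\alpha\in\mathbb{N}$. For $f\in\mathscr{H}_\alpha$ and every integer $n\geq 2$, with $T=\sqrt{\frac{2}{1-\varepsilon}\alpha\ln(n)}$, \[ |I(f)-Q_{n,T}^*(f\rho)|\leq C\|f\|_\alpha\frac{(\ln n)^{\alpha/2+1/4}}{n^\alpha}, \] where the constant $C$ is independent of $n$ and $f$ but depends on $\alpha$ and $\varepsilon$.
   Context: Let $\rho(x)=\frac{1}{\sqrt{2\pi}}\mathrm{e}^{-x^2/2}$ and $L^2_\rho$ the space of (equivalence classes of) measurable $f:\mathbb{R}\to\mathbb{R}$ with $\|f\|_{L^2_\rho}^2=\int_\mathbb{R}|f(x)|^2\rho(x)\,\mathrm{d}x<\infty$. For $\alpha\in\mathbb{N}$, the weighted Sobolev space $\mathscr{H}_\alpha$ is the set of $f\in L^2_\rho$ having weak derivatives $f^{(\tau)}\in L^2_\rho$ for $\tau=1,\dots,\alpha$, with norm $\|f\|_\alpha=(\sum_{\tau=0}^\alpha\|f^{(\tau)}\|_{L^2_\rho}^2)^{1/2}$; elements are identified with their continuous representatives. Let $I(f)=\int_\mathbb{R}f(x)\rho(x)\,\mathrm{d}x$. For $T>0$ and $n\in\mathbb{N}$, the trapezoidal rule is $Q_{n,T}^*(g)=\frac{2T}{n}\sum_{j=0}^{n-1}g(\xi_j^* )$ with $\xi_j^*=\frac{2T}{n}j-T$, $j=0,\dots,n-1$; here it is applied to $g=f\rho$. *)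

(* Defs.v *)
From HB Require Import structures.
From mathcomp Require Import all_boot all_order all_algebra.
From mathcomp Require Import all_classical all_reals all_analysis.
Set Implicit Arguments. Unset Strict Implicit. Unset Printing Implicit Defensive.
Import Order.TTheory GRing.Theory Num.Theory.
Import numFieldNormedType.Exports.
Local Open Scope classical_set_scope.
Local Open Scope ring_scope.

Section Defs.
Variable R : realType.
Let mu := (@lebesgue_measure R).

Definition rho (x : R) : R := expR (- (x ^+ 2) / 2) / Num.sqrt (2 * pi).

Definition L2rho (f : R -> R) : Prop :=
  measurable_fun setT f /\
  (\int[mu]_x ((f x ^+ 2 * rho x)%:E) < +oo)%E.

Definition L2rho_norm2 (f : R -> R) : R :=
  fine (\int[mu]_x ((f x ^+ 2 * rho x)%:E)).

Definition test_fun (phi : R -> R) : Prop :=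
  (forall (k : nat) (x : R), derivable (derive1n k phi) x 1) /\
  (exists M : R, forall x : R, M < `|x| -> phi x = 0).

Definition weak_deriv (tau : nat) (f g : R -> R) : Prop :=
  forall phi, test_fun phi ->
    (\int[mu]_x ((f x * derive1n tau phi x)%:E)
     = ((-1) ^+ tau)%:E * \int[mu]_x ((g x * phi x)%:E))%E.

(* f in H_alpha with (weak) derivatives d tau, tau = 0..alpha (d 0 = f);
   f is the continuous representative *)
Definition in_H (alpha : nat) (f : R -> R) (d : nat -> R -> R) : Prop :=
  continuous f /\ d 0%N = f /\
  forall tau : nat, (tau <= alpha)%N -> L2rho (d tau) /\ weak_deriv tau f (d tau).

Definition H_norm (alpha : nat) (d : nat -> R -> R) : R :=
  Num.sqrt (\sum_(tau < alpha.+1) L2rho_norm2 (d tau)).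

Definition Igauss (f : R -> R) : R := fine (\int[mu]_x ((f x * rho x)%:E)).

Definition trap (n : nat) (T : R) (g : R -> R) : R :=
  (2 * T / n%:R) * \sum_(j < n) g (2 * T / n%:R * j%:R - T).

End Defs.

(* Main.v *)
Require Import Defs.
From HB Require Import structures.
From mathcomp Require Import all_boot all_order all_algebra.
From mathcomp Require Import all_classical all_reals all_analysis.
From mathcomp Require Import measurable_realfun ring lra.
Import Order.TTheory GRing.Theory Num.Theory.
Import numFieldNormedType.Exports.
Local Open Scope ring_scope.
Local Open Scope classical_set_scope.
Set Implicit Arguments.
Unset Strict Implicit.
Unset Printing Implicit Defensive.

(* Write g = f * rho, let h = 2 T / n be the mesh size, and let v 0 be the
   h-periodic function 1 - h * (sum of mollified point masses at the nodes). It
   has mean zero, so it has periodic iterated primitives v j with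
   |v j| <= 2 h^j. Let chi be a smooth cutoff equal to 1 around the nodes in
   [-T, T), whose transitions fit in the two cells next to -T and T. Up to the
   mollification, the quadrature error is the integral of g (1 - chi) plus the
   integral of g chi (v 0). Integrating the latter alpha times by parts against
   the weak derivatives of f leaves a main term of size h^alpha and boundary
   terms that contain chi'. These are supported where |x| >= T - h; since
   eps > 1/2, Cauchy-Schwarz bounds every integral over that region by
   exp (- (1 - eps) (T - h)^2 / 2) = O(n^-alpha). *)

(** * Smooth functions *)

(** The rule evaluates [f] at points, whereas weak derivatives are accessible only through smooth
    compactly supported test functions. Mollified point masses reconcile the two: every function
    multiplying some [d k] is then explicit and smooth, and differentiating [rho] only changes a
    polynomial factor. The price is that [v 0] is of the order of the inverse mollification width.
    Its primitive, however, is a smoothed sawtooth bounded by a multiple of the mesh size whatever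
    the width. The constants therefore do not see the width, which is chosen last, for fixed [f] and
    [n], from the continuity of [f]. The value of T makes exp (- (1 - eps) T^2 / 2) equal to
    n^-alpha. The Gaussian decay given up in passing from 1/2 to 1 - eps pays for the polynomial
    factors. *)

Definition smooth (R : realType) (f : R -> R) : Prop :=
  forall (k : nat) (x : R), derivable (derive1n k f) x 1.

Section Smooth.
Variable R : realType.
Implicit Types (f g : R -> R) (x : R) (p q : {poly R}).

Lemma is_derive_fun1 f g : (forall x, is_derive x 1 f (g x)) -> (derive1 f) = g.
Proof. by move=> fg; apply/funext => x; rewrite derive1E; apply: derive_val. Qed.

(** Spares formulas for higher derivatives: the smoothness proofs below only exhibit a class of
    functions closed under differentiation. *)
Lemma smooth_coind (S : (R -> R) -> Prop) :
  (forall f, S f -> exists2 g, S g & forall x, is_derive x 1 f (g x)) ->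
  forall f, S f -> smooth f.
Proof.
move=> HS f Sf k; elim: k f Sf => [|k IH] f Sf x.
  by have [g _ /(_ x)[]] := HS _ Sf.
rewrite derive1Sn; have [g Sg /is_derive_fun1 ->] := HS _ Sf.
exact: IH.
Qed.

Lemma smooth_derive1 f : smooth f -> smooth (derive1 f).
Proof. by move=> sf k x; rewrite -derive1Sn. Qed.

Lemma smooth_is_derive f x : smooth f -> is_derive x 1 f ((derive1 f) x).
Proof. by move=> sf; rewrite derive1E; apply: derivableP; exact: (sf 0%N). Qed.

Lemma smooth_antideriv f g : smooth f -> (forall x, is_derive x 1 g (f x)) ->
  smooth g.
Proof.
move=> sf gf; apply: (@smooth_coind (fun u => u = g \/ smooth u)); last by left.
move=> u [->|su]; first by exists f => //; right.
exists (derive1 u); first by right; exact: smooth_derive1.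
by move=> x; exact: smooth_is_derive.
Qed.

Lemma is_derive_continuous f (df : R -> R) :
  (forall x, is_derive x 1 f (df x)) -> continuous f.
Proof.
by move=> fd x; apply/differentiable_continuous/derivable1_diffP; have [] := fd x.
Qed.

Lemma smooth_continuous f : smooth f -> continuous f.
Proof.
by move=> sf; apply: (@is_derive_continuous _ (derive1 f)) => x; exact: smooth_is_derive.
Qed.

Lemma is_derive_add f g x (a b : R) : is_derive x 1 f a -> is_derive x 1 g b ->
  is_derive x 1 (fun y => f y + g y) (a + b).
Proof. by move=> fa gb; exact: is_deriveD. Qed.

Lemma is_derive_mul f g x (a b : R) : is_derive x 1 f a -> is_derive x 1 g b ->
  is_derive x 1 (fun y => f y * g y) (a * g x + f x * b).
Proof.
move=> fa gb; apply: (is_derive_eq (is_deriveM fa gb)).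
by rewrite /GRing.scale /=; ring.
Qed.

Lemma is_derive_affine f x (a b c : R) : is_derive (a * x + b) 1 f c ->
  is_derive x 1 (fun y => f (a * y + b)) (a * c).
Proof.
move=> fc; have h : is_derive x 1 (fun y : R => a * y + b) a.
  have hm := is_derive_mul (is_derive_cst a x (1 : R)) (is_derive_id x (1 : R)).
  apply: (is_derive_eq (is_derive_add hm (is_derive_cst b x 1))).
  by rewrite /=; ring.
have hc := @is_derive1_comp _ f (fun y => a * y + b) x c a fc h.
by apply: (is_derive_eq hc); rewrite mulrC.
Qed.

(** Products of smooth functions are not closed under differentiation, but their finite sums are;
    this is the class that replaces the general Leibniz formula. *)
Inductive sum_of_products : (R -> R) -> Prop :=
| sum_of_products_mul f g : smooth f -> smooth g ->
    sum_of_products (fun x => f x * g x)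
| sum_of_products_add f g : sum_of_products f -> sum_of_products g ->
    sum_of_products (fun x => f x + g x).

Lemma smooth_sum_of_products f : sum_of_products f -> smooth f.
Proof.
apply: smooth_coind => {}f; elim=> [u v su sv|u v _ [du Su hu] _ [dv Sv hv]].
  exists (fun x => (derive1 u) x * v x + u x * (derive1 v) x).
    apply: sum_of_products_add; apply: sum_of_products_mul => //;
    exact: smooth_derive1.
  by move=> x; apply: is_derive_mul; exact: smooth_is_derive.
exists (fun x => du x + dv x); first exact: sum_of_products_add.
by move=> x; exact: is_derive_add.
Qed.

Lemma smooth_cst (c : R) : smooth (fun=> c).
Proof.
apply: (@smooth_coind (fun u => exists c, u = fun=> c)); last by exists c.
move=> _ [b ->]; exists (fun=> 0); first by exists 0.
by move=> x; exact: is_derive_cst.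
Qed.

Lemma smoothM f g : smooth f -> smooth g -> smooth (fun x => f x * g x).
Proof. by move=> sf sg; apply/smooth_sum_of_products/sum_of_products_mul. Qed.

Lemma smoothD f g : smooth f -> smooth g -> smooth (fun x => f x + g x).
Proof.
move=> sf sg; have -> : (fun x => f x + g x) = (fun x => f x * 1 + g x * 1).
  by apply/funext => x; rewrite !mulr1.
apply/smooth_sum_of_products/sum_of_products_add;
  by apply: sum_of_products_mul => //; exact: smooth_cst.
Qed.

Lemma smooth_affine f (a b : R) : smooth f -> smooth (fun x => f (a * x + b)).
Proof.
move=> sf; apply: (@smooth_coind (fun u => exists c g, smooth g /\
   u = fun x => c * g (a * x + b))); last first.
  by exists 1, f; split => //; apply/funext => x; rewrite mul1r.
move=> _ [c [g [sg ->]]].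
exists (fun x => c * a * (derive1 g) (a * x + b)).
  by exists (c * a), (derive1 g); split => //; exact: smooth_derive1.
move=> x; have h := is_derive_affine (smooth_is_derive (a * x + b) sg).
apply: (is_derive_eq (is_derive_mul (is_derive_cst c x (1 : R)) h)).
by rewrite /=; ring.
Qed.

Lemma smooth_local f :
  (forall x, exists2 g, smooth g & \forall y \near x, f y = g y) -> smooth f.
Proof.
move: f; apply: (@smooth_coind (fun f => forall x, exists2 g, smooth g &
  \forall y \near x, f y = g y)) => f fl; exists (derive1 f); last first.
  move=> x; have [g sg fg] := fl x; rewrite derive1E; apply: derivableP.
  apply: (@near_eq_derivable _ _ _ g); last exact: (sg 0%N).
  by apply: filterS fg => y ->.
move=> x; have [g sg fg] := fl x; exists (derive1 g); first exact: smooth_derive1.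
have /near_join := fg; apply: filterS => y fgy; rewrite !derive1E.
exact: near_eq_derive.
Qed.

Lemma smooth_horner p : smooth (fun x => p.[x]).
Proof.
apply: (@smooth_coind (fun u => exists p, u = fun x => p.[x])); last by exists p.
move=> _ [q ->]; exists (fun x => q^`().[x]); first by exists q^`()%R.
by move=> x; exact: is_derive_poly.
Qed.

(** Induction on the polynomial: half of the rate [l] goes to the induction hypothesis, the other
    half absorbs the new factor x. *)
Lemma horner_le_expR p (l : R) : 0 < l ->
  exists2 C : R, 0 <= C & forall x, `|p.[x]| <= C * expR (l * `|x|).
Proof.
elim/poly_ind: p l => [|p c IH] l l0.
  by exists 0 => // x; rewrite horner0 normr0 mul0r.
have [|C C0 HC] := IH (l / 2); first by rewrite divr_gt0.
exists (C * (2 / l) + `|c|); first by rewrite addr_ge0// mulr_ge0// divr_ge0// ltW.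
move=> x; rewrite hornerMXaddC (le_trans (ler_normD _ _))// mulrDl lerD//.
  have -> : l * `|x| = l / 2 * `|x| + l / 2 * `|x| by field.
  rewrite expRD normrM.
  have -> : C * (2 / l) * (expR (l / 2 * `|x|) * expR (l / 2 * `|x|)) =
     (C * expR (l / 2 * `|x|)) * (2 / l * expR (l / 2 * `|x|)) by ring.
  apply: ler_pM => //.
  rewrite -ler_pdivrMl ?divr_gt0// invf_div.
  apply: (le_trans _ (expR_ge1Dx _)); lra.
by rewrite ler_peMr// -expR0 ler_expR mulr_ge0// ltW.
Qed.

End Smooth.

(** * A smooth step function *)

Section StepFunction.
Variable R : realType.
Implicit Types (f g : R -> R) (x y : R) (p q : {poly R}).

(** For [q = 1] this is the classical function exp (-1/x) extended by 0. The polynomial in 1/x makes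
    the family closed under differentiation. *)
Definition flat q (x : R) : R := if 0 < x then q.[x^-1] * expR (- x^-1) else 0.

Lemma flat_is_derive q x : is_derive x 1 (flat q) (flat ('X ^+ 2 * (q - q^`()%R)) x).
Proof.
have [x0|x0|<-] := ltgtP 0 x; last first.
- have -> : flat ('X ^+ 2 * (q - q^`()%R)) 0 = 0 by rewrite /flat ltxx.
  apply/is_derive1_caratheodory.
  exists (fun z => if 0 < z then z^-1 * q.[z^-1] * expR (- z^-1) else 0); split.
  + move=> z; rewrite /flat ltxx !subr0; case: ifP => [z0|]; last by rewrite mul0r.
    rewrite -[LHS]mul1r -(mulVf (lt0r_neq0 z0)); ring.
  (* With y = 1/z the slope is z times y^2 q(y) exp (-y), and the latter factor is bounded by
     [C]. *)
  + have [C C0 HC] := horner_le_expR ('X ^+ 2 * q) (@ltr01 R).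
    rewrite /prop_for /continuous_at /= ltxx; apply/cvgr0Pnorm_lt => e e0.
    have C1 : 0 < C + 1 by lra.
    near=> z; case: ifPn => [z0|_]; last by rewrite normr0.
    have zV : 0 < z^-1 by rewrite invr_gt0.
    have := HC z^-1; rewrite hornerM hornerXn mul1r (gtr0_norm zV).
    rewrite -ler_pdivrMr ?expR_gt0// -expRN => HCz.
    have -> : z^-1 * q.[z^-1] * expR (- z^-1) =
        (z ^- 2 * q.[z^-1] * expR (- z^-1)) * z.
      by field; rewrite lt0r_neq0.
    rewrite normrM (gtr0_norm z0) [in ltLHS]normrM (gtr0_norm (expR_gt0 _)).
    rewrite -exprVn; apply: (@le_lt_trans _ _ (C * z)).
      by apply: ler_wpM2r => //; exact: ltW.
    have : z < e / (C + 1).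
      near: z; apply: lt_nbhsl. exact: divr_gt0.
    rewrite ltr_pdivlMr// => h; apply: le_lt_trans h.
    by rewrite mulrC ler_wpM2l// ?ltW// ltrDl.
  + by rewrite ltxx.
- have -> : flat ('X ^+ 2 * (q - q^`()%R)) x = 0.
    by rewrite /flat ltNge (ltW x0).
  apply: (@near_eq_is_derive _ _ _ (fun=> 0)).
  near=> y; rewrite /flat ltNge ltW//=; near: y; exact: lt_nbhsl.
- apply: (@near_eq_is_derive _ _ _ (fun y => q.[y^-1] * expR (- y^-1))).
    have : \forall y \near x, 0 < y by apply: lt_nbhsr.
    by apply: filterS => y y0; rewrite /flat y0.
  have hV : is_derive x 1 (fun y : R => y^-1) (- x ^- 2).
    apply: (is_derive_eq (is_deriveV (lt0r_neq0 x0) (is_derive_id x (1 : R)))).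
    by rewrite /GRing.scale /= mulr1.
  have hq := @is_derive1_comp _ (horner q) (fun y : R => y^-1) x _ _
    (is_derive_poly q x^-1) hV.
  have hN : is_derive x 1 (fun y : R => - y^-1) (x ^- 2).
    by apply: (is_derive_eq (is_deriveN hV)); rewrite opprK.
  have he := @is_derive1_comp _ expR (fun y : R => - y^-1) x _ _
    (is_derive_expR (- x^-1)) hN.
  apply: (is_derive_eq (is_derive_mul hq he)).
  rewrite /flat x0 hornerM hornerXn hornerD hornerN exprVn /=; ring.
Unshelve. all: end_near. Qed.

Lemma smooth_flat q : smooth (flat q).
Proof.
apply: (@smooth_coind _ (fun u => exists q, u = flat q)); last by exists q.
move=> _ [r ->]; exists (flat ('X ^+ 2 * (r - r^`()%R))); first by eexists.
exact: flat_is_derive.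
Qed.

Lemma is_derive_MVT f (df : R -> R) x y : (forall z : R, is_derive z 1 f (df z)) ->
  x <= y -> exists2 c, x <= c <= y & f y - f x = df c * (y - x).
Proof.
move=> fd xy; have [|c] := @MVT_segment _ f df x y xy.
  by apply: continuous_subspaceT; exact: is_derive_continuous fd.
by rewrite in_itv /= => cxy e; exists c.
Qed.

(** The fundamental theorem differentiates the integral from [a] to x only to the right of the base
    point [a]. The base point -|x| - 1 moves with x so as to stay below both x and 0; changing it
    does not affect [J a x - J a 0], so a fixed one serves near each x. *)
Lemma continuous_antideriv f : continuous f ->
  exists F : R -> R, forall x, is_derive x 1 F (f x).
Proof.
move=> cf; pose J a x := (\int[lebesgue_measure]_(t in `[a, x]) f t)%R.
have dJ a x : a < x -> is_derive x 1 (J a) (f x).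
  move=> ax; have x1 : x < x + 1 by rewrite ltrDl.
  have fi : lebesgue_measure.-integrable `[a, x + 1] (EFin \o f).
    apply: continuous_compact_integrable; first exact: segment_compact.
    exact: continuous_subspaceT.
  have [dJa] := @continuous_FTC1_closed R f a x (x + 1) x1 fi ax (cf x).
  by rewrite derive1E => <-; exact: derivableP.
have JJ a b x y : a < x -> b < x -> x <= y -> J a y - J b y = J a x - J b x.
  move=> ax bx xy; have [||c _] := @MVT_segment _ (fun z => J a z - J b z)
    (fun=> 0) x y xy.
  - move=> z /[!in_itv] /= /andP[xz _].
    have ha := dJ a z (lt_trans ax xz); have hb := dJ b z (lt_trans bx xz).
    by apply: (is_derive_eq (is_deriveB ha hb)); rewrite subrr.
  - apply: continuous_in_subspaceT => z; rewrite inE/= in_itv/= => /andP[xz _].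
    have ha := dJ a z (lt_le_trans ax xz); have hb := dJ b z (lt_le_trans bx xz).
    have [dab _] := is_deriveB ha hb.
    by apply/differentiable_continuous/derivable1_diffP.
  - by rewrite mul0r => /eqP; rewrite subr_eq0 => /eqP.
have JJ0 a b x : a < 0 -> b < 0 -> a < x -> b < x -> J a x - J a 0 = J b x - J b 0.
  move=> a0 b0 ax bx; have [x0|x0] := leP 0 x.
    have := JJ a b 0 x a0 b0 x0; lra.
  have := JJ a b x 0 ax bx (ltW x0); lra.
exists (fun x => J (- `|x| - 1) x - J (- `|x| - 1) 0) => x.
have x2 : - `|x| - 2 < x by have := lerNnormlW (lexx `|x|); lra.
apply: (@near_eq_is_derive _ _ _ (fun y => J (- `|x| - 2) y - J (- `|x| - 2) 0)).
  have : x \in `]x - 1, x + 1[%R by rewrite in_itv/=; apply/andP; split; lra.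
  move/near_in_itvoo; apply: filterS => y; rewrite in_itv/= => /andP[y1 y2].
  have nx : - `|x| <= x by have := lerNnormlW (lexx `|x|).
  have ny : - `|y| <= y by have := lerNnormlW (lexx `|y|).
  have := normr_ge0 x; have := normr_ge0 y => ? ?.
  by apply: JJ0; lra.
apply: (is_derive_eq (is_deriveB (dJ _ _ x2) (is_derive_cst _ x (1 : R)))).
by rewrite subr0.
Qed.

(* The bound 2/3 leaves room to fit the transitions of cutoff functions
   between consecutive nodes of the unit grid. *)
Lemma smooth_step_exists : exists H : R -> R, smooth H /\
  (forall x, x <= 0 -> H x = 0) /\ (forall x, 2 / 3 <= x -> H x = 1) /\
  (forall x, 0 <= H x <= 1) /\
  exists2 A : R, 0 <= A & forall x, 0 <= derive1 H x <= A.
Proof.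
pose t x := flat 1 x.
have t0 x : 0 <= t x <= 1.
  rewrite /t /flat; case: ifPn => [x0|_]; last by rewrite lexx ler01.
  by rewrite hornerC mul1r expR_ge0 -expR0 ler_expR oppr_le0 invr_ge0 ltW.
(* A bump supported in [0, 2/3]. The step is its primitive divided by the total mass [c], and since
   [b <= 1] its slope is at most [c^-1]. *)
pose b x := t x * t (- 1 * x + 2 / 3).
have sb : smooth b.
  apply: smoothM; first exact: smooth_flat.
  by apply: (@smooth_affine _ (flat 1)); exact: smooth_flat.
have b01 x : 0 <= b x <= 1.
  have /andP[u0 u1] := t0 x; have /andP[v0 v1] := t0 (- 1 * x + 2 / 3).
  by rewrite mulr_ge0// mulr_ile1.
have bN x : x <= 0 -> b x = 0.
  by move=> x0; rewrite /b /t {1}/flat ltNge x0 mul0r.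
have bP x : 2 / 3 <= x -> b x = 0.
  move=> x0; rewrite /b /t mulrC /flat ltNge.
  have -> : - 1 * x + 2 / 3 <= 0 by lra.
  by rewrite mul0r.
have [B dB] := continuous_antideriv (smooth_continuous sb).
pose c := B (2 / 3) - B 0.
have Bmon x y : x <= y -> B x <= B y.
  move=> xy; have [z _ e] := is_derive_MVT dB xy.
  rewrite -subr_ge0 e mulr_ge0// ?subr_ge0//.
  by have /andP[] := b01 z.
have c0 : 0 < c.
  have c23 : 0 < 2 / 3 :> R by rewrite divr_gt0.
  have [|z] := @MVT _ B b 0 (2 / 3) c23.
    by apply: continuous_subspaceT; exact: is_derive_continuous dB.
  rewrite in_itv/= => /andP[z0 z1] e; rewrite /c e.
  apply: mulr_gt0; last by lra.
  have z2 : 0 < - 1 * z + 2 / 3 by lra.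
  by rewrite /b /t /flat z0 z2 !hornerC !mul1r mulr_gt0// expR_gt0.
pose H x := c^-1 * (B x + - B 0).
have dH x : is_derive x 1 H (c^-1 * b x).
  have h1 := is_derive_add (dB x) (is_derive_cst (- B 0) x (1 : R)).
  apply: (is_derive_eq (is_derive_mul (is_derive_cst c^-1 x (1 : R)) h1)).
  by rewrite /=; ring.
have HN x : x <= 0 -> H x = 0.
  move=> x0; have [z /andP[_ z0] e] := is_derive_MVT dH x0.
  move: e; rewrite (bN _ z0) mulr0 mul0r => /eqP; rewrite subr_eq0 => /eqP <-.
  by rewrite /H subrr mulr0.
have HP x : 2 / 3 <= x -> H x = 1.
  move=> x0; have [z /andP[z0 _] e] := is_derive_MVT dH x0.
  move: e; rewrite (bP _ z0) mulr0 mul0r => /eqP; rewrite subr_eq0 => /eqP ->.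
  by rewrite /H mulVf// lt0r_neq0.
have Hmon x y : x <= y -> H x <= H y.
  move=> xy; apply: ler_wpM2l; first by rewrite invr_ge0 ltW.
  by rewrite lerD2r Bmon.
exists H; split.
  apply: smooth_antideriv dH; apply: smoothM => //; exact: smooth_cst.
do 2 split => //; split.
  move=> x; apply/andP; split.
    by have [x0|/ltW x0] := leP x 0; [rewrite HN|rewrite -(HN 0) ?Hmon].
  by have [x0|/ltW x0] := leP (2 / 3) x; [rewrite HP|rewrite -(HP (2 / 3)) ?Hmon].
exists c^-1; first by rewrite invr_ge0 ltW.
move=> x; rewrite (is_derive_fun1 dH).
have /andP[h1 h2] := b01 x.
have cV : 0 <= c^-1 by rewrite invr_ge0 ltW.
by rewrite mulr_ge0//= ler_piMr.
Qed.

End StepFunction.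

(** * Periodic kernels *)

Section PeriodicKernel.
Variable R : realType.
Implicit Types (u v : R -> R) (x y : R).

Definition periodic1 u := forall x, u (x + 1) = u x.

Lemma periodic1_int u x (m : int) : periodic1 u -> u (x + m%:~R) = u x.
Proof.
move=> pu; have pn y (n : nat) : u (y + n%:R) = u y.
  elim: n => [|n IH]; first by rewrite addr0.
  by rewrite -natr1 addrA pu.
case: m => n; first exact: pn.
by rewrite NegzE rmorphN/= -(pn _ n.+1) subrK.
Qed.

(** [cW.1] is the mean of [u] over a period; subtracting it makes the primitive [cW.2] periodic. As
    the mean is a value of [u], the recentred function has a zero, from which it can be bounded. *)
Lemma periodic1_primitive u : continuous u -> periodic1 u ->
  exists cW : R * (R -> R),
    (forall x, is_derive x 1 cW.2 (u x - cW.1)) /\ periodic1 cW.2 /\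
    exists y, u y = cW.1.
Proof.
move=> cu pu; have [W dW] := continuous_antideriv cu.
pose c := W 1 - W 0.
have Wc x : W (x + 1) - W x = c.
  pose D := fun y => W (1 * y + 1) - W y.
  have dD y : is_derive y 1 D 0.
    have h : is_derive (1 * y + 1) 1 W (u (1 * y + 1)) by exact: dW.
    apply: (is_derive_eq (is_deriveB (is_derive_affine h) (dW y))).
    by rewrite !mul1r pu subrr.
  have := is_derive_0_is_cst x 0 dD.
  by rewrite /D !mul1r add0r.
exists (c, fun x => W x - c * x) => /=; split; [|split].
- move=> x; have hc := is_derive_mul (is_derive_cst c x (1 : R)) (is_derive_id x (1 : R)).
  apply: (is_derive_eq (is_deriveB (dW x) hc)).
  by rewrite /=; ring.
- by move=> x /=; have := Wc x; lra.
- have [y _] := is_derive_MVT dW (@ler01 R).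
  by rewrite subr0 mulr1 => e; exists y; rewrite /c.
Qed.

(* The primitives w (j + 1) are normalised to take the value 0, so that by
   periodicity the mean value theorem bounds them by the sup of w j. *)
Lemma periodic1_iterated_primitives u : smooth u -> periodic1 u ->
  (forall x, `|u x| <= 1) -> exists w : nat -> R -> R,
  [/\ forall j, smooth (w j), forall j x, is_derive x 1 (w j.+1) (w j x),
      forall j x, `|w j.+1 x| <= 2 & w 0%N = derive1 u].
Proof.
move=> su pu u1.
have /choice[nxt nxtP] : forall v : R -> R, exists cW : R * (R -> R),
    continuous v -> periodic1 v ->
    (forall x, is_derive x 1 cW.2 (v x - cW.1)) /\ periodic1 cW.2 /\
    exists y, v y = cW.1.
  (* The pair [(0, v)] is a dummy that makes the choice function total; the iteration only meets
     continuous periodic functions. *)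
  move=> v; have [cv|ncv] := pselect (continuous v); last by exists (0, v).
  have [pv|npv] := pselect (periodic1 v); last by exists (0, v).
  by have [cW h] := periodic1_primitive cv pv; exists cW.
pose z j := iter j (fun v => (nxt v).2) u.
have zP j : smooth (z j) /\ periodic1 (z j).
  elim: j => [//|j [sz pz]].
  have [dz [pz' _]] := nxtP _ (smooth_continuous sz) pz.
  split; last by [].
  apply: smooth_antideriv dz; apply: smoothD => //; exact: smooth_cst.
(* Subtracting the mean of [z i] leaves derivatives unchanged, so the functions chain. The chain
   starts one derivative below [u]: [w 1] is [u] minus its mean. *)
pose w j := if j is i.+1 then (fun x => z i x - (nxt (z i)).1) else derive1 u.
have dw j x : is_derive x 1 (w j.+1) (w j x).
  have [sz pz] := zP j.
  case: j sz pz => [|j] sz pz.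
    apply: (is_derive_eq (is_deriveB (smooth_is_derive x sz) (is_derive_cst _ x (1 : R)))).
    by rewrite subr0.
  have [sz' pz'] := zP j.
  have [dz _] := nxtP _ (smooth_continuous sz') pz'.
  apply: (is_derive_eq (is_deriveB (dz x) (is_derive_cst _ x (1 : R)))).
  by rewrite subr0.
exists w; split => //.
- case=> [|j]; first exact: smooth_derive1.
  by apply: smoothD; [have [] := zP j|exact: smooth_cst].
- elim=> [|j IH] x.
    have [sz pz] := zP 0%N.
    have [_ [_ [y e]]] := nxtP _ (smooth_continuous sz) pz.
    rewrite /w -e (le_trans (ler_normB _ _))//.
    have := u1 x; have := u1 y; rewrite /z /=; lra.
  have [sz pz] := zP j.+1.
  have [_ [_ [y e]]] := nxtP _ (smooth_continuous sz) pz.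
  (* Shifting by [m] brings x into [y, y + 1), within distance 1 of the zero y; hence the bound 2
     does not grow with j. *)
  pose m := Num.floor (x - y); pose x' := x - m%:~R.
  have wy : w j.+2 y = 0 by rewrite /w e subrr.
  have -> : w j.+2 x = w j.+2 x'.
    by rewrite /w /x' -mulrNz periodic1_int.
  have /andP[m0 m1] := floor_itv (x - y); rewrite -/m in m0 m1.
  rewrite intrD in m1.
  have yx : y <= x' by rewrite /x'; lra.
  have [c _] := is_derive_MVT (dw j.+1) yx.
  rewrite wy subr0 => ->; rewrite normrM.
  have h : `|x' - y| <= 1 by rewrite ger0_norm /x'; lra.
  by apply: (@le_trans _ _ (2 * 1)); [exact: ler_pM|rewrite mulr1].
Qed.

(** The function 1 minus unit spikes at the integers is the derivative of the smoothed sawtooth t -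
    H(t / dl), with t the fractional part of x. The sawtooth lies in [-1, 1] for every [dl], which
    is why the bounds on the primitives are uniform in the width. *)
Lemma sawtooth_kernel (H : R -> R) (dl : R) : smooth H ->
  (forall x, x <= 0 -> H x = 0) -> (forall x, 2 / 3 <= x -> H x = 1) ->
  (forall x, 0 <= H x <= 1) -> 0 < dl -> dl <= 1 ->
  exists w : nat -> R -> R,
  [/\ forall j, smooth (w j), forall j x, is_derive x 1 (w j.+1) (w j x),
      forall j x, `|w j.+1 x| <= 2 &
      forall x, w 0%N x = 1 - dl^-1 * derive1 H (dl^-1 * (x - (Num.floor x)%:~R))].
Proof.
move=> sH H0 H1 H01 d0 d1.
pose K (i : int) y := - 1 * (i%:~R + H (dl^-1 * y + - (dl^-1 * i%:~R))) + y.
have sK i : smooth (K i).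
  apply: smoothD; last first.
    by have := @smooth_horner R 'X; congr smooth; apply/funext => y; rewrite hornerX.
  apply: smoothM; first exact: smooth_cst.
  apply: smoothD; first exact: smooth_cst.
  exact: smooth_affine.
pose u x := K (Num.floor x) x.
(* Branches of consecutive cells agree on the last third of the earlier cell: there its own step is
   complete, as 2/3 * dl <= 2/3, and the next one has not begun. Each branch thus extends past the
   integer where it starts, and the sawtooth is smooth there. *)
have uK x y : (Num.floor x)%:~R - 1 / 3 < y < (Num.floor x)%:~R + 1 -> u y = K (Num.floor x) y.
  move=> /andP[y1 y2]; rewrite /u; have [y3|y3] := leP (Num.floor x)%:~R y.
    by rewrite (@floor_def _ y (Num.floor x)) // y3 intrD.
  rewrite (@floor_def _ y (Num.floor x - 1)); last first.
    by rewrite subrK y3 intrD; lra.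
  rewrite /K -!mulrBr (H0 (_ * (y - (Num.floor x)%:~R))); last first.
    by rewrite pmulr_rle0 ?invr_gt0// subr_le0 ltW.
  rewrite H1; first by rewrite intrD; lra.
  rewrite intrD -ler_pdivrMl ?invr_gt0// invrK.
  have : dl * (2 / 3) <= 1 * (2 / 3) by apply: ler_wpM2r => //; rewrite divr_ge0.
  lra.
have ux x : \forall y \near x, u y = K (Num.floor x) y.
  have /andP[m0 m1] := floor_itv x; rewrite intrD in m1.
  have : x \in `](Num.floor x)%:~R - 1 / 3, (Num.floor x)%:~R + 1[%R.
    by rewrite in_itv/=; apply/andP; split; lra.
  by move/near_in_itvoo; apply: filterS => y; rewrite in_itv/=; exact: uK.
have su : smooth u by apply: smooth_local => x; exists (K (Num.floor x)).
have pu : periodic1 u.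
  move=> x; rewrite /u floorDrz ?int_num1// floor1 /K.
  have -> : dl^-1 * (x + 1) + - (dl^-1 * (Num.floor x + 1)%:~R) =
     dl^-1 * x + - (dl^-1 * (Num.floor x)%:~R) by rewrite intrD; ring.
  by rewrite intrD; ring.
have u1 x : `|u x| <= 1.
  have /andP[m0 m1] := floor_itv x; rewrite intrD in m1.
  rewrite /u /K.
  have /andP[] := H01 (dl^-1 * x - dl^-1 * (Num.floor x)%:~R).
  by move=> h0 h1; rewrite ler_norml; apply/andP; split; lra.
have [w [sw dw w2 w0]] := periodic1_iterated_primitives su pu u1.
exists w; split => // x; rewrite w0 derive1E (near_eq_derive _ (ux x)).
have hH := is_derive_affine
  (smooth_is_derive (dl^-1 * x + - (dl^-1 * (Num.floor x)%:~R)) sH).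
have h1 := is_derive_add (is_derive_cst ((Num.floor x)%:~R : R) x (1 : R)) hH.
have h2 := is_derive_mul (is_derive_cst (- 1 : R) x (1 : R)) h1.
have h3 := is_derive_add h2 (is_derive_id x (1 : R)).
have := @derive_val _ _ _ _ _ _ _ h3.
rewrite /K => ->; rewrite /= mulrBr; ring.
Qed.

End PeriodicKernel.

(** * Gaussian weights *)

Section GaussianWeight.
Variable R : realType.
Implicit Types (u : R -> R) (x : R) (p : {poly R}).
Notation mu := (@lebesgue_measure R).

Lemma rhoE x : rho x = expR (- x ^+ 2 / 2) / Num.sqrt (2 * pi).
Proof. by []. Qed.

Lemma rho_gt0 x : 0 < rho x.
Proof. by rewrite divr_gt0 ?expR_gt0// sqrtr_gt0 mulr_gt0// pi_gt0. Qed.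

Lemma is_derive_rho x : is_derive x 1 (@rho R) (- x * rho x).
Proof.
have h1 := is_derive_mul (is_derive_id x (1 : R)) (is_derive_id x (1 : R)).
have h2 := is_derive_mul h1 (is_derive_cst (- 2^-1 : R) x (1 : R)).
have h3 := is_derive1_comp (is_derive_expR _) h2.
have h4 := is_derive_mul h3 (is_derive_cst ((Num.sqrt (2 * pi))^-1 : R) x (1 : R)).
have -> : @rho R = fun x => expR (id x * id x * - 2^-1) * (Num.sqrt (2 * pi))^-1.
  by apply/funext => y; rewrite /rho /=; congr (expR _ / _); rewrite expr2; field.
by apply: (is_derive_eq h4); rewrite /cst /=; field; rewrite gt_eqF// sqrtr_gt0 mulr_gt0// pi_gt0.
Qed.

Lemma is_derive_horner_rho p x :
  is_derive x 1 (fun y => p.[y] * rho y) ((p^`()%R - 'X * p).[x] * rho x).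
Proof.
apply: (is_derive_eq (is_derive_mul (is_derive_poly p x) (is_derive_rho x))).
by rewrite hornerD hornerN hornerM hornerX; ring.
Qed.

Lemma smooth_horner_rho p : smooth (fun y => p.[y] * rho y).
Proof.
apply: (@smooth_coind _ (fun u => exists p, u = fun y => p.[y] * rho y)); last by exists p.
move=> _ [q ->]; exists (fun y => (q^`()%R - 'X * q).[y] * rho y); first by eexists.
by move=> x; exact: is_derive_horner_rho.
Qed.

Lemma continuous_rho : continuous (@rho R).
Proof. exact: (is_derive_continuous is_derive_rho). Qed.

Lemma integrable_gauss (c : R) : 0 < c ->
  mu.-integrable setT (EFin \o (fun x => expR (- (c * x ^+ 2)))).
Proof.
move=> c0; pose s := Num.sqrt (2 * c)^-1.
have s0 : 0 < s by rewrite sqrtr_gt0 invr_gt0 mulr_gt0.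
have sN : s != 0 by rewrite gt_eqF.
have := integrable_normal_pdf 0 s.
move=> /(integrableZl measurableT (normal_peak s)^-1).
apply: eq_integrable => // x _.
rewrite /normal_pdf (negbTE sN) /normal_fun -EFinM mulrA.
rewrite mulVf ?mul1r ?gt_eqF ?normal_peak_gt0//; congr (expR _)%:E.
rewrite subr0 sqr_sqrtr ?invr_ge0 ?mulr_ge0// 1?ltW//.
by field; rewrite gt_eqF.
Qed.

Lemma rho_ge0 x : 0 <= rho x. Proof. exact/ltW/rho_gt0. Qed.

Local Opaque rho.

(** Real-valued, so that one inequality [|m x| <= M * outside a x] records both the size and the
    support of a weight; [a = 0] gives a plain sup bound. *)
Definition outside (a x : R) : R := (a <= `|x|)%R%:R.

Lemma outside_ge0 a x : 0 <= outside a x. Proof. exact: ler0n. Qed.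

Lemma outsideXX a x : outside a x * outside a x = outside a x.
Proof. by rewrite /outside; case: (_ <= _); rewrite ?mulr1 ?mulr0. Qed.

Lemma measurable_outside a : measurable_fun setT (outside a).
Proof.
have -> : outside a = \1_[set x : R | (a <= `|x|)%R].
  apply/funext => x; rewrite indicE /outside; congr ((nat_of_bool _)%:R).
  by apply/idP/idP => [h|/set_mem//]; exact/mem_set.
apply: measurable_indic.
rewrite -[X in measurable X]setTI.
exact: (measurable_fun_le measurableT (measurable_cst a) (@normr_measurable R setT)).
Qed.

(** The Gaussian exponent splits as 1/2 = (1 - eps) + ka with ka = eps - 1/2 > 0. On |x| >= a the
    first part yields the tail factor. Half of ka absorbs the growth exp (2|x|) of the squared
    polynomial, at the cost of the factor exp (2 / ka), and the other half leaves an integrable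
    Gaussian. *)
Lemma horner_rho_tail (eps : R) p : 1 / 2 < eps -> eps < 1 ->
  exists2 C : R, 0 <= C & forall a : R, 0 <= a ->
    mu.-integrable setT (EFin \o (fun x => p.[x] ^+ 2 * rho x * outside a x)) /\
    (\int[mu]_x (p.[x] ^+ 2 * rho x * outside a x) <=
     C * expR (- ((1 - eps) * a ^+ 2)))%R.
Proof.
move=> e0 e1; have [C1 C10 HC] := horner_le_expR p (@ltr01 R).
pose ka := eps - 1 / 2; have ka0 : 0 < ka by rewrite /ka; lra.
have ka2 : 0 < ka / 2 by lra.
pose D := C1 ^+ 2 * expR (2 / ka) / Num.sqrt (2 * pi).
have sp : 0 < Num.sqrt (2 * pi) :> R by rewrite sqrtr_gt0 mulr_gt0// pi_gt0.
have D0 : 0 <= D by rewrite !mulr_ge0 ?sqr_ge0 ?expR_ge0// invr_ge0 ltW.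
pose G x := expR (- (ka / 2 * x ^+ 2)).
have iG := integrable_gauss ka2.
have pw a x : 0 <= a -> 0 <= p.[x] ^+ 2 * rho x * outside a x <=
    D * expR (- ((1 - eps) * a ^+ 2)) * G x.
  move=> a0; apply/andP; split.
    apply: mulr_ge0; last exact: outside_ge0.
    by apply: mulr_ge0; [exact: sqr_ge0|exact: rho_ge0].
  have [ax|ax] := boolP (a <= `|x|); last first.
    rewrite /outside (negbTE ax) mulr0.
    by apply: mulr_ge0; [apply: mulr_ge0|]; rewrite ?expR_ge0.
  rewrite /outside ax mulr1.
  have p2 : p.[x] ^+ 2 <= C1 ^+ 2 * expR (2 * `|x|).
    rewrite -(real_normK (num_real p.[x])) mulr_natl mulr2n expRD -expr2 -exprMn.
    by rewrite lerXn2r ?nnegrE ?mulr_ge0 ?expR_ge0// -[X in expR X]mul1r.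
  apply: (@le_trans _ _ (C1 ^+ 2 * expR (2 * `|x|) * rho x)).
    exact: ler_wpM2r (rho_ge0 x) _ _ p2.
  have -> : C1 ^+ 2 * expR (2 * `|x|) * rho x =
      C1 ^+ 2 / Num.sqrt (2 * pi) * expR (2 * `|x| + - x ^+ 2 / 2).
    by rewrite expRD rhoE; ring.
  have -> : D * expR (- ((1 - eps) * a ^+ 2)) * G x = C1 ^+ 2 / Num.sqrt (2 * pi) *
     expR (2 / ka + - ((1 - eps) * a ^+ 2) + - (ka / 2 * x ^+ 2)).
    by rewrite !expRD /D /G; ring.
  apply: ler_wpM2l; first by rewrite divr_ge0 ?sqr_ge0// ltW.
  rewrite ler_expR.
  have amgm : 2 * `|x| <= ka / 2 * x ^+ 2 + 2 / ka.
    rewrite -subr_ge0 -(real_normK (num_real x)).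
    have -> : ka / 2 * `|x| ^+ 2 + 2 / ka - 2 * `|x| = ka / 2 * (`|x| - 2 / ka) ^+ 2.
      by field; rewrite gt_eqF.
    by rewrite mulr_ge0 ?sqr_ge0// ltW.
  have ax2 : (1 - eps) * a ^+ 2 <= (1 - eps) * x ^+ 2.
    rewrite ler_wpM2l//; first lra.
    by rewrite -(real_normK (num_real x)) lerXn2r// nnegrE.
  have kx : ka * x ^+ 2 = eps * x ^+ 2 - x ^+ 2 / 2 by rewrite /ka; field.
  lra.
have mf a : measurable_fun setT (fun x => p.[x] ^+ 2 * rho x * outside a x).
  apply: measurable_funM; last exact: measurable_outside.
  apply: measurable_funM; last exact: continuous_measurable_fun continuous_rho.
  apply: measurable_funX; exact: (continuous_measurable_fun (@continuous_horner R p)).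
exists (D * \int[mu]_x G x)%R.
  by apply: mulr_ge0 => //; apply: Rintegral_ge0 => x _; exact: expR_ge0.
move=> a a0.
have iDG : mu.-integrable setT (EFin \o (fun x => D * expR (- ((1 - eps) * a ^+ 2)) * G x)).
  have := integrableZl measurableT (D * expR (- ((1 - eps) * a ^+ 2))) iG.
  by apply: eq_integrable.
have ia : mu.-integrable setT (EFin \o (fun x => p.[x] ^+ 2 * rho x * outside a x)).
  apply: le_integrable iDG => //; first by apply/measurable_EFinP; exact: mf.
  move=> x _ /=; have /andP[h0 h1] := pw a x a0.
  by rewrite lee_fin (ger0_norm h0) (ger0_norm (le_trans h0 h1)).
split => //.
have -> : (D * (\int[mu]_x G x) * expR (- ((1 - eps) * a ^+ 2)) =
    \int[mu]_x (D * expR (- ((1 - eps) * a ^+ 2)) * G x))%R.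
  by rewrite RintegralZl//; ring.
by apply: le_Rintegral => // x _; have /andP[] := pw a x a0.
Qed.

(** The optimal t is sqrt B / sqrt A. Since A or B may vanish, both roots are shifted by a small
    [r], chosen so that the loss r (sqrt A + sqrt B) is at most [e]. *)
Lemma le_sqrtM_of_amgm (A B X : R) : 0 <= A -> 0 <= B ->
  (forall t : R, 0 < t -> 2 * X <= t * A + t^-1 * B) ->
  X <= Num.sqrt A * Num.sqrt B.
Proof.
move=> A0 B0 H; set al := Num.sqrt A; set be := Num.sqrt B.
have al0 : 0 <= al by rewrite sqrtr_ge0.
have be0 : 0 <= be by rewrite sqrtr_ge0.
have Aal : A = al ^+ 2 by rewrite sqr_sqrtr.
have Bbe : B = be ^+ 2 by rewrite sqr_sqrtr.
apply/ler_addgt0Pr => e e0.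
have s0 : 0 < al + be + 1 by lra.
pose r := e / (al + be + 1); have r0 : 0 < r by rewrite divr_gt0.
have ar : 0 < al + r by lra. have br : 0 < be + r by lra.
have := H ((be + r) / (al + r)) (divr_gt0 br ar); rewrite invf_div Aal Bbe.
have h1 : (be + r) / (al + r) * al ^+ 2 <= (be + r) * al.
  rewrite -mulrA ler_pM2l// mulrC ler_pdivrMr// expr2 ler_wpM2l//; lra.
have h2 : (al + r) / (be + r) * be ^+ 2 <= (al + r) * be.
  rewrite -mulrA ler_pM2l// mulrC ler_pdivrMr// expr2 ler_wpM2l//; lra.
have h3 : r * (al + be) <= e.
  rewrite /r mulrAC ler_pdivrMr// ler_pM2l//; lra.
lra.
Qed.

(** Cauchy-Schwarz for the weight [rho], through the pointwise bound |F| <= M/2 (t fA + fB / t): t =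
    1 gives integrability, and all t > 0 together give the product of norms. The square root halves
    the exponent of the tail. *)
Lemma weighted_bound (eps : R) p : 1 / 2 < eps -> eps < 1 ->
  exists2 C : R, 0 <= C & forall (u m : R -> R) (M a : R),
    L2rho u -> measurable_fun setT m -> 0 <= M -> 0 <= a ->
    (forall x, `|m x| <= M * outside a x) ->
    mu.-integrable setT (EFin \o (fun x => u x * (p.[x] * rho x * m x))) /\
    (`|\int[mu]_x (u x * (p.[x] * rho x * m x))| <=
     C * M * Num.sqrt (L2rho_norm2 u) * expR (- ((1 - eps) / 2 * a ^+ 2)))%R.
Proof.
move=> e0 e1; have [C C0 HC] := horner_rho_tail p e0 e1.
exists (Num.sqrt C); first exact: sqrtr_ge0.
move=> u m M a [mu_u Lu] mm M0 a0 mM; have [iB leB] := HC _ a0.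
set F := fun x => u x * (p.[x] * rho x * m x).
pose fA x := u x ^+ 2 * rho x; pose fB x := p.[x] ^+ 2 * rho x * outside a x.
have mrho := continuous_measurable_fun continuous_rho.
have mhor := continuous_measurable_fun (@continuous_horner R p).
have mA : measurable_fun setT fA.
  by apply: measurable_funM => //; exact: measurable_funX.
have fA0 x : 0 <= fA x by rewrite mulr_ge0 ?sqr_ge0// rho_ge0.
have iA : mu.-integrable setT (EFin \o fA).
  apply/integrableP; split; first exact/measurable_EFinP.
  by under eq_integral do rewrite /= ger0_norm//.
have mF : measurable_fun setT F.
  apply: measurable_funM => //; apply: measurable_funM => //.
  exact: measurable_funM.
have pw (t : R) x : 0 < t -> `|F x| <= M * 2^-1 * t * fA x + M * 2^-1 * t^-1 * fB x.
  move=> t0; rewrite /F 3!normrM (gtr0_norm (rho_gt0 x)).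
  apply: (@le_trans _ _ (`|u x| * (`|p.[x]| * rho x * (M * outside a x)))).
    by rewrite ler_wpM2l// ler_wpM2l// mulr_ge0// rho_ge0.
  rewrite /fA /fB -(outsideXX a x) -(real_normK (num_real (u x))) -(real_normK (num_real p.[x])).
  set U := `|u x|; set P := `|p.[x]|; set o := outside a x; set r := rho x.
  have ol : o <= 1 by rewrite lern1 leq_b1.
  have o2 : o * o = o by rewrite /o outsideXX.
  have r0 : 0 < r := rho_gt0 x.
  rewrite o2 -subr_ge0.
  have -> : M * 2^-1 * t * (U ^+ 2 * r) + M * 2^-1 * t^-1 * (P ^+ 2 * r * o) -
     U * (P * r * (M * o)) = M * 2^-1 * t * r * (U ^+ 2 * (1 - o) + o * (U - t^-1 * P) ^+ 2).
    by field; rewrite gt_eqF.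
  have i2 : 0 <= 2^-1 :> R by rewrite invr_ge0.
  apply: mulr_ge0.
    exact: (mulr_ge0 (mulr_ge0 (mulr_ge0 M0 i2) (ltW t0)) (ltW r0)).
  apply: addr_ge0; apply: mulr_ge0; rewrite ?sqr_ge0 ?outside_ge0//.
  by rewrite subr_ge0.
have iAB (t : R) : mu.-integrable setT
    (EFin \o (fun x => M * 2^-1 * t * fA x + M * 2^-1 * t^-1 * fB x)).
  have := integrableD measurableT (integrableZl measurableT (M * 2^-1 * t) iA)
    (integrableZl measurableT (M * 2^-1 * t^-1) iB).
  by apply: eq_integrable.
have iF : mu.-integrable setT (EFin \o F).
  apply: le_integrable (iAB 1) => //; first exact/measurable_EFinP.
  move=> x _ /=; rewrite lee_fin; apply: (le_trans (pw _ x ltr01)).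
  exact: ler_norm.
split => //.
have -> : Num.sqrt C * M * Num.sqrt (L2rho_norm2 u) * expR (- ((1 - eps) / 2 * a ^+ 2)) =
    M * (Num.sqrt (L2rho_norm2 u) * Num.sqrt (C * expR (- ((1 - eps) * a ^+ 2)))).
  rewrite sqrtrM//.
  have -> : - ((1 - eps) * a ^+ 2) = - ((1 - eps) / 2 * a ^+ 2) + - ((1 - eps) / 2 * a ^+ 2).
    by field.
  by rewrite expRD -expr2 sqrtr_sqr (ger0_norm (expR_ge0 _)); ring.
have A0 : 0 <= L2rho_norm2 u.
  by apply: (@Rintegral_ge0 _ _ _ mu setT fA) => x _; exact: fA0.
set B := C * _ in leB *; have B0 : 0 <= B.
  by apply: mulr_ge0 => //; exact: expR_ge0.
have -> : M * (Num.sqrt (L2rho_norm2 u) * Num.sqrt B) =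
    Num.sqrt (M * L2rho_norm2 u) * Num.sqrt (M * B).
  by rewrite !sqrtrM// mulrACA -expr2 sqr_sqrtr.
apply: (le_trans (le_normr_Rintegral measurableT iF)).
apply: le_sqrtM_of_amgm; [exact: mulr_ge0|exact: mulr_ge0|move=> t t0].
have iaF : mu.-integrable setT (EFin \o (fun x => `|F x|)) by exact: integrable_norm.
have := le_Rintegral measurableT iaF (iAB t) (fun x _ => pw t x t0).
rewrite RintegralD//; last 2 first.
- by apply: eq_integrable (integrableZl measurableT (M * 2^-1 * t) iA).
- by apply: eq_integrable (integrableZl measurableT (M * 2^-1 * t^-1) iB).
rewrite !RintegralZl// => h.
have h2 : M * 2^-1 * t^-1 * (\int[mu]_x fB x)%R <= M * 2^-1 * t^-1 * B.
  have i2 : 0 <= 2^-1 :> R by rewrite invr_ge0.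
  by apply: ler_wpM2l leB; apply: mulr_ge0; [exact: mulr_ge0|rewrite invr_ge0 ltW].
have -> : t * (M * L2rho_norm2 u) + t^-1 * (M * B) =
    2 * (M * 2^-1 * t * L2rho_norm2 u + M * 2^-1 * t^-1 * B) by field; rewrite gt_eqF.
by rewrite ler_pM2l// (le_trans h)// lerD2l.
Qed.

End GaussianWeight.

(** * Integration by parts *)

Section IntegrationByParts.
Variable R : realType.
Implicit Types (f phi chi : R -> R) (d v : nat -> R -> R) (x : R) (p : {poly R}).
Notation mu := (@lebesgue_measure R).

(** The definition relates each [d k] to [f], not to its neighbours. Testing [d k] against phi' and
    [d k.+1] against phi produces the same integral of [f] against the derivative of phi of order k
    + 1, with opposite signs. *)
Lemma in_H_parts (alpha : nat) f d (k : nat) phi :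
  in_H alpha f d -> (k < alpha)%N -> test_fun phi ->
  (\int[mu]_x (d k x * derive1 phi x) = - \int[mu]_x (d k.+1 x * phi x))%R.
Proof.
move=> [_ [_ H]] ka [sphi [M HM]].
have tphi' : test_fun (derive1 phi).
  split; first exact: smooth_derive1.
  exists M => x Mx; rewrite derive1E.
  rewrite (@near_eq_derive _ _ _ _ (fun=> 0)) ?derive_cst//.
  have : \forall y \near x, M < `|y|.
    exact: (cvgr_gt _ (@norm_continuous _ R^o x) _ Mx).
  by apply: filterS => y; exact: HM.
have [_ /(_ _ tphi')] := H k (ltnW ka).
have [_ /(_ phi (conj sphi (ex_intro _ M HM)))] := H k.+1 ka.
rewrite derive1Sn => -> /esym; rewrite exprS mulN1r EFinN mulNe.
rewrite /Rintegral -fineN -signr_odd; case: (odd k).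
  by rewrite expr1 EFinN !mulN1e !oppeK => <-; rewrite oppeK.
by rewrite expr0 !mul1e => ->.
Qed.

(* The cutoff chi varies only where |x| >= a, that is, where the Gaussian tail
   is already small, and does so on the scale h. The kernel v 0 contains the
   mollified point masses, so only its primitives have bounds in terms of h. *)
Record cutoff_kernel (A h a : R) (chi : R -> R) v : Prop := CutoffKernel {
  ck_smooth : forall j, smooth (v j);
  ck_derive : forall j x, is_derive x 1 (v j.+1) (v j x);
  ck_bound : forall j x, `|v j.+1 x| <= 2 * h ^+ j.+1;
  ck_bound0 : exists B : R, forall x, `|v 0%N x| <= B;
  ck_smooth_cutoff : smooth chi;
  ck_support : exists M : R, forall x, M < `|x| -> chi x = 0;
  ck_cutoff : forall x, 0 <= chi x <= 1;
  ck_derive_cutoff : forall x, `|derive1 chi x| <= A / h * outside a x }.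

Lemma outside0 x : outside 0 x = 1.
Proof. by rewrite /outside normr_ge0. Qed.

(** Induction on the number [m] of integrations by parts left. Each one raises [v j] to [v j.+1] and
    leaves three terms: the derivative falls on [d k], on [p * rho], which turns [p] into p' - X p,
    or on the cutoff; hence the generality in [p], [k] and [j]. The condition [0 < j + m] ensures
    that at [m = 0] the kernel is a primitive, which is bounded in terms of [h]. *)
Lemma parts_bound (eps A h0 : R) : 1 / 2 < eps -> eps < 1 -> 0 <= A -> 0 <= h0 ->
  forall (m : nat) p, exists2 C : R, 0 <= C &
  forall (alpha : nat) f d (k j : nat) v chi (N h a : R),
  in_H alpha f d -> (k + m <= alpha)%N -> (0 < j + m)%N ->
  (forall i, (i <= alpha)%N -> Num.sqrt (L2rho_norm2 (d i)) <= N) ->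
  cutoff_kernel A h a chi v -> 0 < h -> h <= h0 -> 0 <= a ->
  `|(\int[mu]_x (d k x * (p.[x] * rho x * (chi x * v j x))))%R| <=
    C * N * h ^+ j * (h ^+ m + expR (- ((1 - eps) / 2 * a ^+ 2))).
Proof.
move=> e0 e1 A0 h00; elim=> [|m IH] p.
  have [C C0 HC] := weighted_bound p e0 e1.
  exists (2 * C); first by rewrite mulr_ge0.
  move=> alpha f d k j v chi N h a Hf ka + HN K hp hh a0.
  case: j => // j _; rewrite addn0 in ka.
  have N0 : 0 <= N by apply: le_trans (HN 0%N _) => //; exact: sqrtr_ge0.
  have [_ [_ /(_ k ka)[Ld _]]] := Hf.
  have mm : measurable_fun setT (fun x => chi x * v j.+1 x).
    apply: continuous_measurable_fun; apply: smooth_continuous.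
    by apply: smoothM; [exact: ck_smooth_cutoff K|exact: ck_smooth K _].
  have hj : 0 <= 2 * h ^+ j.+1 by rewrite mulr_ge0// exprn_ge0// ltW.
  (* At [m = 0] the factor h^m + exp (...) is at least 1, so the bound over the whole line, [a = 0],
     suffices. *)
  have [|_ h1] := HC _ _ _ 0 Ld mm hj (lexx 0).
    move=> x; rewrite outside0 mulr1 normrM.
    have /andP[c0 c1] := ck_cutoff K x.
    rewrite (ger0_norm c0) -[leRHS]mul1r.
    by apply: ler_pM => //; exact: (ck_bound K).
  apply: (le_trans h1); rewrite expr0n /= mulr0 oppr0 expR0 mulr1.
  have -> : 2 * C * N * h ^+ j.+1 * (1 + expR (- ((1 - eps) / 2 * a ^+ 2))) =
    C * (2 * h ^+ j.+1) * N * (1 + expR (- ((1 - eps) / 2 * a ^+ 2))) by ring.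
  rewrite -[leLHS]mulr1; apply: ler_pM => //.
  - by apply: mulr_ge0; [exact: mulr_ge0|exact: sqrtr_ge0].
  - by apply: ler_wpM2l; [exact: mulr_ge0|exact: HN].
  - by rewrite lerDl expR_ge0.
have [C1 C10 H1] := IH p.
have [C2 C20 H2] := IH (p^`()%R - 'X * p).
have [C3 C30 H3] := weighted_bound p e0 e1.
have [C4 C40 H4] := weighted_bound (p^`()%R - 'X * p) e0 e1.
exists ((C1 + C2) * (1 + h0) + 2 * A * C3).
  by rewrite addr_ge0// ?mulr_ge0// addr_ge0.
move=> alpha f d k j v chi N h a Hf ka _ HN K hp hh a0.
have N0 : 0 <= N by apply: le_trans (HN 0%N _) => //; exact: sqrtr_ge0.
have kal : (k < alpha)%N by apply: leq_trans ka; rewrite addnS ltnS leq_addr.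
have [_ [_ /(_ k (ltnW kal))[Ld _]]] := Hf.
set q := p^`()%R - 'X * p.
pose phi x := p.[x] * rho x * (chi x * v j.+1 x).
have schi := ck_smooth_cutoff K; have sv := ck_smooth K.
have tphi : test_fun phi.
  split; first by apply: smoothM; [exact: smooth_horner_rho|exact: smoothM].
  have [M HM] := ck_support K.
  by exists M => x Mx; rewrite /phi HM// mul0r mulr0.
have dphi x : derive1 phi x = q.[x] * rho x * (chi x * v j.+1 x) +
   (p.[x] * rho x * (derive1 chi x * v j.+1 x) + p.[x] * rho x * (chi x * v j x)).
  have hc := is_derive_mul (smooth_is_derive x schi) (ck_derive K j x).
  rewrite derive1E (@derive_val _ _ _ _ _ _ _ (is_derive_mul (is_derive_horner_rho p x) hc)).
  by rewrite /q; ring.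
have mM chi1 i : smooth chi1 -> measurable_fun setT (fun x => chi1 x * v i x).
  move=> s1; apply: continuous_measurable_fun; apply: smooth_continuous.
  exact: smoothM.
have hj : 0 <= 2 * h ^+ j.+1 by rewrite mulr_ge0// exprn_ge0// ltW.
have cvb x : `|chi x * v j.+1 x| <= 2 * h ^+ j.+1 * outside 0 x.
  rewrite outside0 mulr1 normrM.
  have /andP[c0 c1] := ck_cutoff K x.
  by rewrite (ger0_norm c0) -[leRHS]mul1r; apply: ler_pM => //; exact: (ck_bound K).
have [i1 _] := H4 _ _ _ 0 Ld (mM _ j.+1 schi) hj (lexx 0) cvb.
(* The cutoff term loses 1/h from chi' but gains a power from [v j.+1]: it is of order h^j, times
   the tail factor. *)
have Ah : 0 <= A / h * (2 * h ^+ j.+1) by rewrite mulr_ge0// divr_ge0// ltW.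
have [|i2 b2] := H3 _ _ _ a Ld (mM _ j.+1 (smooth_derive1 schi)) Ah a0.
  move=> x; rewrite normrM mulrAC; apply: ler_pM => //.
    exact: (ck_derive_cutoff K).
  exact: (ck_bound K).
(* For [j = 0] this bound depends on the mollification width; it serves integrability only and does
   not enter the constant. *)
have [B HB] : exists B : R, forall x, `|v j x| <= B.
  case: (j) => [|i]; first exact: (ck_bound0 K).
  by exists (2 * h ^+ i.+1) => x; exact: (ck_bound K).
have B0 : 0 <= B := le_trans (normr_ge0 _) (HB 0).
have [|i3 _] := H3 _ _ _ 0 Ld (mM _ j schi) B0 (lexx 0).
  move=> x; rewrite outside0 mulr1 normrM.
  have /andP[c0 c1] := ck_cutoff K x.
  by rewrite (ger0_norm c0) -[leRHS]mul1r; apply: ler_pM.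
have := in_H_parts Hf kal tphi.
under eq_Rintegral do rewrite dphi mulrDr mulrDr.
rewrite RintegralD//; last first.
  have := integrableD measurableT i2 i3; exact: eq_integrable.
rewrite RintegralD//.
have km : (k.+1 + m <= alpha)%N by rewrite addSnnS.
have km' : (k + m <= alpha)%N by apply: leq_trans ka; rewrite leq_add2l.
have := H1 _ _ _ k.+1 j.+1 v chi N h a Hf km isT HN K hp hh a0.
have := H2 _ _ _ k j.+1 v chi N h a Hf km' isT HN K hp hh a0.
move: b2; rewrite -/q /phi.
set I1 := Rintegral _ _ _; set I2 := Rintegral _ _ _.
set I3 := Rintegral _ _ _; set I4 := Rintegral _ _ _.
set E := expR _; move=> b1 b2 b3 eqn.
have -> : I4 = - I3 - I2 - I1 by lra.
have E0 : 0 <= E := expR_ge0 _.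
have hm0 : 0 <= h ^+ m.+1 by rewrite exprn_ge0// ltW.
have X0 : 0 <= N * h ^+ j by rewrite mulr_ge0// exprn_ge0// ltW.
(* The extra power of [h] completes h^m to h^(m+1); in front of the tail it is bounded by [h0]. *)
have scale C : 0 <= C -> C * N * h ^+ j.+1 * (h ^+ m + E) <=
    C * (1 + h0) * (N * h ^+ j * (h ^+ m.+1 + E)).
  move=> C0.
  have -> : C * N * h ^+ j.+1 * (h ^+ m + E) = C * (N * h ^+ j * (h ^+ m.+1 + h * E)).
    by rewrite !exprS; ring.
  rewrite -[leRHS]mulrA; apply: ler_wpM2l => //.
  rewrite [leRHS]mulrCA; apply: ler_wpM2l => //.
  have := ler_wpM2r E0 hh; have := mulr_ge0 h00 hm0; lra.
have b1' : `|I1| <= 2 * A * C3 * (N * h ^+ j * (h ^+ m.+1 + E)).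
  apply: (le_trans b1).
  have -> : C3 * (A / h * (2 * h ^+ j.+1)) * Num.sqrt (L2rho_norm2 (d k)) * E =
      2 * A * C3 * (Num.sqrt (L2rho_norm2 (d k)) * h ^+ j * E).
    by rewrite exprS; field; rewrite gt_eqF.
  apply: ler_wpM2l; first by rewrite !mulr_ge0.
  apply: ler_pM => //; last by rewrite lerDr.
    by rewrite mulr_ge0 ?sqrtr_ge0// exprn_ge0// ltW.
  apply: ler_wpM2r; first by rewrite exprn_ge0// ltW.
  exact: (HN _ (ltnW kal)).
have := le_trans b2 (scale _ C20); have := le_trans b3 (scale _ C10).
have -> : ((C1 + C2) * (1 + h0) + 2 * A * C3) * N * h ^+ j * (h ^+ m.+1 + E) =
  C1 * (1 + h0) * (N * h ^+ j * (h ^+ m.+1 + E)) +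
  C2 * (1 + h0) * (N * h ^+ j * (h ^+ m.+1 + E)) +
  2 * A * C3 * (N * h ^+ j * (h ^+ m.+1 + E)) by ring.
move=> b3' b2'.
apply: (le_trans (ler_normB _ _)); apply: lerD => //.
by apply: (le_trans (ler_normB _ _)); rewrite normrN; apply: lerD.
Qed.

End IntegrationByParts.

(** * Approximate point masses *)

Section Quadrature.
Variable R : realType.
Implicit Types (f g : R -> R) (x : R).
Notation mu := (@lebesgue_measure R).

Lemma gauss_bound (eps : R) : 1 / 2 < eps -> eps < 1 ->
  exists2 C : R, 0 <= C & forall (u m : R -> R) (M a : R),
    L2rho u -> measurable_fun setT m -> 0 <= M -> 0 <= a ->
    (forall x, `|m x| <= M * outside a x) ->
    mu.-integrable setT (EFin \o (fun x => u x * rho x * m x)) /\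
    (`|\int[mu]_x (u x * rho x * m x)| <=
     C * M * Num.sqrt (L2rho_norm2 u) * expR (- ((1 - eps) / 2 * a ^+ 2)))%R.
Proof.
move=> e0 e1; have [C C0 HC] := weighted_bound 1 e0 e1; exists C => //.
move=> u m M a Lu mm M0 a0 mM; have := HC u m M a Lu mm M0 a0 mM.
have -> // : (fun x => u x * ((1 : {poly R}).[x] * rho x * m x)) =
   (fun x => u x * rho x * m x).
by apply/funext => x; rewrite hornerC mul1r mulrA.
Qed.

Lemma derive1_near_cst f (c x : R) : (\forall y \near x, f y = c) -> derive1 f x = 0.
Proof.
move=> fc; rewrite derive1E (@near_eq_derive _ _ _ _ (fun=> c)) ?derive_cst//.
Qed.

Lemma Rintegral_sum (n : nat) (F : nat -> R -> R) :
  (forall i, (i < n)%N -> mu.-integrable setT (EFin \o F i)) ->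
  mu.-integrable setT (EFin \o (fun x => \sum_(i < n) F i x)) /\
  (\int[mu]_x (\sum_(i < n) F i x) = \sum_(i < n) \int[mu]_x F i x)%R.
Proof.
elim: n => [|n IH] iF.
  have -> : (fun x => \sum_(i < 0) F i x) = (fun=> 0).
    by apply/funext => x; rewrite big_ord0.
  rewrite big_ord0 Rintegral_cst// mul0r; split=> //; exact: integrable0.
have [i1 e1] := IH (fun i hi => iF i (ltnW hi)).
have i2 := iF n (ltnSn n).
have -> : (fun x => \sum_(i < n.+1) F i x) = (fun x => \sum_(i < n) F i x + F n x).
  by apply/funext => x; rewrite big_ord_recr.
rewrite big_ord_recr/= RintegralD// e1; split => //.
by have := integrableD measurableT i1 i2; exact: eq_integrable.
Qed.

(** The spike is nonnegative, supported in [xi, xi + 1/c] and of total mass H(1) - H(0) = 1, so the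
    integral is an average of [g] just to the right of xi. *)
Lemma spike_approx (H g : R -> R) (c xi e : R) : smooth H ->
  (forall x, x <= 0 -> H x = 0) -> (forall x, 2 / 3 <= x -> H x = 1) ->
  (forall x, 0 <= derive1 H x) -> 0 < c -> continuous g ->
  (forall x, xi <= x <= xi + c^-1 -> `|g x - g xi| <= e) ->
  `|(\int[mu]_x (g x * (c * derive1 H (c * x + - (c * xi)))))%R - g xi| <= e.
Proof.
move=> sH H0 H1 dH0 c0 cg ge.
pose k x := c * derive1 H (c * x + - (c * xi)).
pose D : set R := [set` `[xi, xi + c^-1]%R].
have c1 : 0 < c^-1 by rewrite invr_gt0.
have xc : xi < xi + c^-1 by rewrite ltrDl.
have mD : measurable D by exact: measurable_itv.
have k0 x : 0 <= k x by rewrite mulr_ge0 ?dH0// ltW.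
have sk : smooth k.
  apply: smoothM; first exact: smooth_cst.
  by apply: smooth_affine; exact: smooth_derive1.
have ck := smooth_continuous sk.
have kout x : ~ D x -> k x = 0.
  rewrite /D /= in_itv/= => /negP; rewrite negb_and -!ltNge => /orP[xl|xg].
    rewrite /k (@derive1_near_cst _ 0) ?mulr0//.
    have : c * x + - (c * xi) < 0 by rewrite -mulrBr pmulr_rlt0// subr_lt0.
    by move=> /lt_nbhsl; apply: filterS => y /ltW; exact: H0.
  rewrite /k (@derive1_near_cst _ 1) ?mulr0//.
  have : 2 / 3 < c * x + - (c * xi).
    rewrite -mulrBr; apply: (@lt_trans _ _ 1); first lra.
    by rewrite -ltr_pdivrMl// mulr1 ltrBrDl.
  by move=> /lt_nbhsr; apply: filterS => y /ltW; exact: H1.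
have iD (u : R -> R) : continuous u -> mu.-integrable D (EFin \o u).
  move=> cu; apply: continuous_compact_integrable; first exact: segment_compact.
  exact: continuous_subspaceT.
have ik : (\int[mu]_(x in D) k x = 1)%R.
  pose F x := H (c * x + - (c * xi)).
  have dF x : is_derive x 1 F (k x).
    exact: is_derive_affine (smooth_is_derive _ sH).
  have cF := is_derive_continuous dF.
  rewrite /Rintegral (@continuous_FTC2 R k F xi (xi + c^-1)) //.
  - rewrite -EFinB /= /F mulrDr mulfV ?gt_eqF// subrr (H0 0 (lexx 0)) subr0 H1//.
    lra.
  - exact: continuous_subspaceT.
  - split; first by move=> x _; have [] := dF x.
      by apply: cvg_at_right_filter; exact: cF.
    by apply: cvg_at_left_filter; exact: cF.
  - by move=> x _; rewrite (is_derive_fun1 dF).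
have -> : (\int[mu]_x (g x * k x) = \int[mu]_(x in D) (g x * k x))%R.
  rewrite [RHS]Rintegral_mkcond; apply: eq_Rintegral => x _.
  rewrite patchE; case: ifPn => // /negP xD; rewrite kout ?mulr0//.
  by move=> Dx; apply: xD; exact: mem_set.
have igk : mu.-integrable D (EFin \o (fun x => (g x - g xi) * k x)).
  apply: iD => x; apply: cvgM; last exact: ck.
  by apply: cvgB; [exact: cg|exact: cvg_cst].
have ik' : mu.-integrable D (EFin \o k) by exact: iD.
have -> : g xi = (\int[mu]_(x in D) (g xi * k x))%R by rewrite RintegralZl// ik mulr1.
rewrite -RintegralB//; last 2 first.
- by apply: iD => x; apply: cvgM; [exact: cg|exact: ck].
- by apply: iD => x; apply: cvgM; [exact: cvg_cst|exact: ck].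
under eq_Rintegral do rewrite -mulrBl.
apply: (le_trans (le_normr_Rintegral _ igk)) => //.
have -> : e = (\int[mu]_(x in D) (e * k x))%R by rewrite RintegralZl// ik mulr1.
apply: le_Rintegral => //.
- exact: integrable_norm.
- by apply: iD => x; apply: cvgM; [exact: cvg_cst|exact: ck].
- move=> x Dx; rewrite normrM (ger0_norm (k0 x)); apply: ler_wpM2r => //.
  by apply: ge; move: Dx; rewrite /D /= in_itv.
Qed.

(** All spikes share one width, so the radii of continuity at the finitely many nodes are replaced
    by their minimum. *)
Lemma common_modulus g (xi : nat -> R) (n : nat) (e : R) : continuous g -> 0 < e ->
  exists2 r : R, 0 < r & forall i x, (i < n)%N ->
    xi i <= x <= xi i + r -> `|g x - g (xi i)| <= e.
Proof.
move=> cg e0; elim: n => [|n [r r0 Hr]]; first by exists 1.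
have /cvgrPdist_le/(_ e e0)/nbhs_ballP[s /= s0 Hs] := cg (xi n).
exists (Num.min r (s / 2)); first by rewrite lt_min r0 divr_gt0.
move=> i x; rewrite ltnS leq_eqVlt => /orP[/eqP ->|lin] /andP[h1 h2].
  rewrite distrC; apply: Hs; rewrite /ball /= distrC ger0_norm ?subr_ge0//.
  have : Num.min r (s / 2) <= s / 2 by rewrite ge_min lexx orbT.
  lra.
apply: Hr => //; rewrite h1/=; apply: (le_trans h2).
by rewrite lerD2l ge_min lexx.
Qed.

End Quadrature.

(** * Error of the trapezoidal rule *)

Section TrapezoidError.
Variable R : realType.
Implicit Types (f g : R -> R) (x : R).
Notation mu := (@lebesgue_measure R).

Lemma derive1_step_eq0 (H : R -> R) x :
  (forall x, x <= 0 -> H x = 0) -> (forall x, 2 / 3 <= x -> H x = 1) ->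
  x < 0 \/ 2 / 3 < x -> derive1 H x = 0.
Proof.
move=> H0 H1 [/lt_nbhsl|/lt_nbhsr] nx.
  by apply: (@derive1_near_cst _ _ 0); apply: filterS nx => y /ltW; exact: H0.
by apply: (@derive1_near_cst _ _ 1); apply: filterS nx => y /ltW; exact: H1.
Qed.

(* The cutoff takes the values 0 or 1 on the spikes and selects exactly those
   at the nodes 0, ..., n - 1. *)
Lemma cutoff_spikes (H : R -> R) (dl s : R) (n : nat) :
  (forall x, x <= 0 -> H x = 0) -> (forall x, 2 / 3 <= x -> H x = 1) ->
  0 < dl -> dl <= 1 / 2 ->
  H (s + 2 / 3) * H (n%:R - s) *
    (dl^-1 * derive1 H (dl^-1 * (s - (Num.floor s)%:~R))) =
  \sum_(i < n) dl^-1 * derive1 H (dl^-1 * (s - i%:R)).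
Proof.
move=> H0 H1 d0 d1.
have d2 : 2 <= dl^-1 by rewrite -[leLHS]invrK lef_pV2 ?posrE ?invr_gt0//; lra.
have dH := derive1_step_eq0 H0 H1.
have dHn t : t < 0 -> derive1 H (dl^-1 * t) = 0.
  by move=> t0; apply: dH; left; rewrite pmulr_rlt0// invr_gt0.
(* As [dl <= 1 / 2], a spike ends within the first third of its cell. *)
have dHp t : 1 / 3 < t -> derive1 H (dl^-1 * t) = 0.
  move=> t0; apply: dH; right.
  have : 2 * t <= dl^-1 * t by apply: ler_wpM2r => //; lra.
  lra.
have /andP[m0 m1] := floor_itv s; rewrite intrD in m1.
have [fs|fs] := leP 0 (Num.floor s); last first.
  have s0 : s < 0 by rewrite -floor_lt0.
  rewrite big1; last first.
    move=> i _; rewrite dHn ?mulr0//.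
    have : 0 <= i%:R :> R by []. lra.
  (* In the cell [-1, 0) the cutoff vanishes up to -2/3, and beyond that point the spike of node -1
     is over. *)
  have [s1|s1] := leP s (- (2 / 3)).
    by rewrite (H0 (s + 2 / 3)) ?mul0r//; lra.
  have -> : Num.floor s = (- 1)%R :> int.
    by apply: floor_def; rewrite mulrN1z; apply/andP; split; lra.
  by rewrite dHp ?mulr0//; rewrite mulrN1z; lra.
have : Num.floor s = `|Num.floor s|%N by rewrite gez0_abs.
move: `|Num.floor s|%N => k ks; rewrite ks -!pmulrn in m0 m1 *.
have [kn|kn] := ltnP k n; last first.
  have kn' : n%:R <= k%:R :> R by rewrite ler_nat.
  rewrite (H0 (n%:R - s)); last by lra.
  rewrite mulr0 mul0r big1// => i _.
  rewrite dHp ?mulr0//.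
  have : i.+1%:R <= n%:R :> R by rewrite ler_nat ltn_ord.
  rewrite -natr1; lra.
rewrite (bigD1 (Ordinal kn)) //= big1 ?addr0; last first.
  move=> i ik.
  have [ik'|ik'|ik'] := ltngtP i k.
  - rewrite dHp ?mulr0//.
    have : i.+1%:R <= k%:R :> R by rewrite ler_nat.
    rewrite -natr1; lra.
  - rewrite dHn ?mulr0//.
    have : k.+1%:R <= i%:R :> R by rewrite ler_nat.
    rewrite -natr1; lra.
  - by move: ik; rewrite -val_eqE /= ik' eqxx.
(* On the spike of node k < n, s >= 0 and n - s >= 2/3, so both cutoff factors equal 1. *)
have [sk|sk] := leP (s - k%:R) (1 / 3); last by rewrite dHp ?mulr0.
have kn' : k.+1%:R <= n%:R :> R by rewrite ler_nat.
have k0 : 0 <= k%:R :> R by [].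
rewrite -natr1 in kn'.
by rewrite !H1 ?mul1r//; lra.
Qed.

(** In the coordinate s = (x + T) / h node i is the integer i, and the factor h^j compensates the
    chain rule. The cutoff rises for s in [-2/3, 0] and falls for s in [n - 2/3, n], both within |x|
    >= T - h; the product of two steps of slope at most A / h gives the constant 2A. *)
Lemma cutoff_kernel_exists (H : R -> R) (A : R) : smooth H ->
  (forall x, x <= 0 -> H x = 0) -> (forall x, 2 / 3 <= x -> H x = 1) ->
  (forall x, 0 <= H x <= 1) -> (forall x, 0 <= derive1 H x <= A) ->
  forall (dl h T : R) (n : nat), 0 < dl -> dl <= 1 / 2 -> 0 < h -> 2 * T = h * n%:R ->
  h <= T -> exists v chi,
  [/\ cutoff_kernel (2 * A) h (T - h) chi v,
      forall x, `|1 - chi x| <= outside (T - h) x &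
      forall x, chi x * v 0%N x = chi x -
        \sum_(i < n) h * ((dl * h)^-1 *
          derive1 H ((dl * h)^-1 * x + - ((dl * h)^-1 * (h * i%:R - T))))].
Proof.
move=> sH H0 H1 H01 dHA dl h T n d0 d1 h0 Tn hT.
have d11 : dl <= 1 by lra.
have [w [sw dw w2 w0]] := sawtooth_kernel sH H0 H1 H01 d0 d11.
have hV : 0 < h^-1 by rewrite invr_gt0.
have hVh : h^-1 * h = 1 by rewrite mulVf// gt_eqF.
have nT : n%:R = 2 * (h^-1 * T).
  by rewrite mulrCA Tn mulrA hVh mul1r.
pose v j x := h ^+ j * w j (h^-1 * x + h^-1 * T).
pose s1 x := h^-1 * x + (h^-1 * T + 2 / 3).
pose s2 x := - h^-1 * x + (n%:R - h^-1 * T).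
pose chi x := H (s1 x) * H (s2 x).
have A0 : 0 <= A by have /andP[a b] := dHA 0; exact: le_trans b.
have dHz := derive1_step_eq0 H0 H1.
have inside x : `|x| < T - h -> 2 / 3 < s1 x /\ 2 / 3 < s2 x.
  rewrite ltr_norml => /andP[x1 x2].
  have : h^-1 * h < h^-1 * (x + T) by rewrite ltr_pM2l//; lra.
  have : h^-1 * h < h^-1 * (T - x) by rewrite ltr_pM2l//; lra.
  by rewrite hVh /s1 /s2 nT => ? ?; split; lra.
exists v, chi; split.
- split.
  + move=> j; apply: smoothM; first exact: smooth_cst.
    exact: smooth_affine.
  + move=> j x.
    have hw := is_derive_affine (dw j (h^-1 * x + h^-1 * T)).
    apply: (is_derive_eq (is_derive_mul (is_derive_cst (h ^+ j.+1) x (1 : R)) hw)).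
    by rewrite /= mul0r add0r exprS /v; field; rewrite gt_eqF.
  + move=> j x; have hj : 0 <= h ^+ j.+1 by rewrite exprn_ge0// ltW.
    by rewrite /v normrM (ger0_norm hj) mulrC; apply: ler_wpM2r.
  + exists (1 + dl^-1 * A) => x; rewrite /v expr0 mul1r w0.
    apply: (le_trans (ler_normB _ _)); rewrite normr1 lerD2l.
    set y := dl^-1 * (_ - _); have /andP[y0 y1] := dHA y.
    rewrite ger0_norm; last by rewrite mulr_ge0// invr_ge0 ltW.
    by apply: ler_wpM2l => //; rewrite invr_ge0 ltW.
  + by apply: smoothM; exact: smooth_affine.
  + exists (T + h) => x Tx.
    have [xT|xT] : T < x \/ x < - (T + h).
      have [x0|x0] := leP 0 x; first by left; move: Tx; rewrite ger0_norm//; lra.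
      by right; move: Tx; rewrite ltr0_norm//; lra.
    * rewrite /chi (H0 (s2 x)) ?mulr0//.
      have : h^-1 * (T - x) <= 0 by rewrite pmulr_rle0//; lra.
      by rewrite /s2 nT; lra.
    * rewrite /chi (H0 (s1 x)) ?mul0r//.
      have : h^-1 * (x + T) <= h^-1 * (- h) by rewrite ler_pM2l//; lra.
      by rewrite mulrN hVh /s1; lra.
  + move=> x; have /andP[a0 a1] := H01 (s1 x); have /andP[b0 b1] := H01 (s2 x).
    by rewrite /chi mulr_ge0// mulr_ile1.
  + move=> x.
    have -> : derive1 chi x = h^-1 * derive1 H (s1 x) * H (s2 x) +
        H (s1 x) * (- h^-1 * derive1 H (s2 x)).
      have e1 := is_derive_affine (smooth_is_derive (s1 x) sH).
      have e2 := is_derive_affine (smooth_is_derive (s2 x) sH).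
      by rewrite derive1E (@derive_val _ _ _ _ _ _ _ (is_derive_mul e1 e2)).
    have [xa|xa] := leP (T - h) `|x|; last first.
      have [i1 i2] := inside _ xa.
      rewrite (dHz (s1 x)) ?(dHz (s2 x)); try by right.
      by rewrite !mulr0 mul0r addr0 normr0 mulr_ge0 ?outside_ge0 ?divr_ge0 ?mulr_ge0// ltW.
    rewrite /outside xa mulr1.
    have /andP[a0 a1] := H01 (s1 x); have /andP[b0 b1] := H01 (s2 x).
    have /andP[p0 p1] := dHA (s1 x); have /andP[q0 q1] := dHA (s2 x).
    apply: (le_trans (ler_normD _ _)).
    have -> : 2 * A / h = h^-1 * A * 1 + 1 * (h^-1 * A) by ring.
    rewrite !normrM normrN !(ger0_norm p0) !(ger0_norm q0) !(ger0_norm a0) !(ger0_norm b0).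
    rewrite (ger0_norm (ltW hV)).
    apply: lerD; apply: ler_pM => //; rewrite ?mulr_ge0 ?(ltW hV)//.
      by apply: ler_wpM2l => //; exact: ltW.
    by apply: ler_wpM2l => //; exact: ltW.
- move=> x; have [xa|xa] := leP (T - h) `|x|; last first.
    have [i1 i2] := inside _ xa.
    by rewrite /chi !H1 ?mul1r ?subrr ?normr0 ?outside_ge0// ltW.
  have -> : outside (T - h) x = 1 by rewrite /outside xa.
  have /andP[a0 a1] := H01 (s1 x); have /andP[b0 b1] := H01 (s2 x).
  have c1 : chi x <= 1 by rewrite /chi mulr_ile1.
  have c0 : 0 <= chi x by rewrite /chi mulr_ge0.
  by rewrite ler_norml; apply/andP; split; lra.
- move=> x; rewrite /v expr0 mul1r w0 mulrBr mulr1; congr (_ - _).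
  rewrite /chi.
  have -> : s1 x = (h^-1 * x + h^-1 * T) + 2 / 3 by rewrite /s1; ring.
  have -> : s2 x = n%:R - (h^-1 * x + h^-1 * T) by rewrite /s2; ring.
  rewrite cutoff_spikes//; apply: eq_bigr => i _.
  rewrite mulrA; congr (_ * derive1 H _); first by field; rewrite !gt_eqF.
  by field; rewrite !gt_eqF.
Qed.

Lemma trapezoid_error (eps h0 : R) (alpha : nat) : 1 / 2 < eps -> eps < 1 ->
  (0 < alpha)%N -> 0 <= h0 -> exists2 C : R, 0 <= C &
  forall f d (n : nat) (N h T : R), in_H alpha f d ->
  (forall i, (i <= alpha)%N -> Num.sqrt (L2rho_norm2 (d i)) <= N) ->
  0 < h -> h <= h0 -> 2 * T = h * n%:R -> h <= T ->
  `|Igauss f - h * \sum_(i < n) (f (h * i%:R - T) * rho (h * i%:R - T))| <=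
  C * N * (h ^+ alpha + expR (- ((1 - eps) / 2 * (T - h) ^+ 2))).
Proof.
move=> e0 e1 al0 h00.
have [H [sH [H0 [H1 [H01 [A A0 dHA]]]]]] := smooth_step_exists R.
have A20 : 0 <= 2 * A by rewrite mulr_ge0.
have [C1 C10 HC1] := parts_bound e0 e1 A20 h00 alpha 1.
have [C2 C20 HC2] := gauss_bound e0 e1.
exists (C1 + C2); first exact: addr_ge0.
move=> f d n N h T Hf HN hp hh Tn hT.
have [cf [d0 HL]] := Hf.
have Lf : L2rho f by rewrite -d0; have [] := HL 0%N isT.
have T0 : 0 < T by exact: lt_le_trans hT.
pose g x := f x * rho x.
have cg : continuous g.
  by move=> x; apply: cvgM; [exact: cf|exact: continuous_rho].
have N0 : 0 <= N by apply: le_trans (HN 0%N _) => //; exact: sqrtr_ge0.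
set E := expR _; have E0 : 0 <= E := expR_ge0 _.
apply/ler_addgt0Pr => e ep.
(* Each of the [n] nodes carries the weight [h], and n h = 2T, so this tolerance adds up to [e]. *)
have e'0 : 0 < e / (2 * T) by rewrite divr_gt0// mulr_gt0.
have [r r0 Hr] := common_modulus (fun i => h * i%:R - T) n cg e'0.
(* The bound 1/2 keeps the spikes clear of the transitions of the cutoff; r / h keeps their support
   within the radius of continuity. [C1] and [C2] are already fixed. *)
pose dl := Num.min (1 / 2) (r / h).
have dl0 : 0 < dl by rewrite lt_min !divr_gt0.
have dl1 : dl <= 1 / 2 by rewrite ge_min lexx.
have dlh : dl * h <= r.
  rewrite -ler_pdivlMr//; by rewrite ge_min lexx orbT.
have [v [chi [K chi1 Kid]]] := cutoff_kernel_exists sH H0 H1 H01 dHA dl0 dl1 hp Tn hT.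
pose c := (dl * h)^-1; have c0 : 0 < c by rewrite invr_gt0 mulr_gt0.
pose k (i : nat) x := h * (c * derive1 H (c * x + - (c * (h * i%:R - T)))).
have sk i : smooth (k i).
  apply: smoothM; first exact: smooth_cst.
  apply: smoothM; first exact: smooth_cst.
  by apply: smooth_affine; exact: smooth_derive1.
have schi := ck_smooth_cutoff K.
have msm (u : R -> R) : smooth u -> measurable_fun setT u.
  by move=> su; apply: continuous_measurable_fun; exact: smooth_continuous.
have a0 : 0 <= T - h by rewrite subr_ge0.
have ik i : mu.-integrable setT (EFin \o (fun x => g x * k i x)).
  have hcA : 0 <= h * (c * A) by rewrite !mulr_ge0// ltW.
  have [|//] := HC2 f (k i) (h * (c * A)) 0 Lf (msm _ (sk i)) hcA (lexx 0).
  move=> x; rewrite outside0 mulr1 /k.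
  set y := c * x + _; have /andP[y0 y1] := dHA y.
  rewrite ger0_norm; last by rewrite !mulr_ge0// ltW.
  by do 2 (apply: ler_wpM2l; first exact: ltW).
have ic : mu.-integrable setT (EFin \o (fun x => g x * chi x)).
  have [|//] := HC2 f chi 1 0 Lf (msm _ schi) ler01 (lexx 0).
  move=> x; rewrite outside0 mulr1.
  by have /andP[x0 x1] := ck_cutoff K x; rewrite ger0_norm.
have m1c : measurable_fun setT (fun x => 1 - chi x).
  by apply: measurable_funB => //; exact: msm.
have [|i1c b1c] := HC2 f (fun x => 1 - chi x) 1 (T - h) Lf m1c ler01 a0.
  by move=> x; rewrite mul1r; exact: chi1.
have [isum esum] := Rintegral_sum (fun i (_ : (i < n)%N) => ik i).
have eqI : Igauss f = (\int[mu]_x (g x * (1 - chi x)) + \int[mu]_x (g x * chi x))%R.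
  rewrite -RintegralD//; apply: eq_Rintegral => x _ /=; rewrite /g; ring.
have eqK : (\int[mu]_x (d 0%N x * ((1 : {poly R}).[x] * rho x * (chi x * v 0%N x))) =
   \int[mu]_x (g x * chi x) - \sum_(i < n) \int[mu]_x (g x * k i x))%R.
  rewrite -esum -RintegralB//; apply: eq_Rintegral => x _ /=.
  by rewrite -mulr_sumr d0 hornerC mul1r Kid -/c /k /g mulrA -mulrBr.
have := HC1 alpha f d 0%N 0%N v chi N h (T - h) Hf (leqnn _) al0 HN K hp hh a0.
rewrite eqK expr0 mulr1 => bK.
have bS : `|\sum_(i < n) ((\int[mu]_x (g x * k i x))%R - h * g (h * i%:R - T))| <= e.
  apply: (le_trans (ler_norm_sum _ _ _)).
  apply: (@le_trans _ _ (\sum_(i < n) h * (e / (2 * T)))); last first.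
    rewrite sumr_const card_ord -[leLHS]mulr_natr.
    have -> : h * (e / (2 * T)) * n%:R = h * n%:R * (e / (2 * T)) by ring.
    by rewrite -Tn mulrC divfK// gt_eqF// mulr_gt0.
  apply: ler_sum => i _.
  have dH0 x : 0 <= derive1 H x by have /andP[] := dHA x.
  pose J := (\int[mu]_x (g x * (c * derive1 H (c * x + - (c * (h * i%:R - T))))))%R.
  have hJ : `|J - g (h * i%:R - T)| <= e / (2 * T).
    apply: (spike_approx sH H0 H1 dH0 c0 cg) => x.
    rewrite /c invrK => /andP[x1 x2]; apply: Hr => //.
    by rewrite x1 (le_trans x2)// lerD2l.
  have -> : (\int[mu]_x (g x * k i x) = h * J)%R.
    have -> : J = (\int[mu]_x (h^-1 * (g x * k i x)))%R.
      by apply: eq_Rintegral => x _; rewrite /k; field; rewrite gt_eqF.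
    by rewrite RintegralZl// mulrA mulfV ?mul1r// gt_eqF.
  by rewrite -mulrBr normrM gtr0_norm// ler_wpM2l// ltW.
have bX : `|(\int[mu]_x (g x * (1 - chi x)))%R| <= C2 * N * (h ^+ alpha + E).
  apply: (le_trans b1c); rewrite mulr1; apply: ler_pM => //.
  - by rewrite mulr_ge0// sqrtr_ge0.
  - by apply: ler_wpM2l => //; rewrite -d0; exact: HN.
  - by rewrite lerDr exprn_ge0// ltW.
have -> : Igauss f - h * \sum_(i < n) (f (h * i%:R - T) * rho (h * i%:R - T)) =
    (\int[mu]_x (g x * (1 - chi x)))%R +
    ((\int[mu]_x (g x * chi x))%R - \sum_(i < n) (\int[mu]_x (g x * k i x))%R) +
    \sum_(i < n) ((\int[mu]_x (g x * k i x))%R - h * g (h * i%:R - T)).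
  by rewrite eqI big_split /= sumrN mulr_sumr; ring.
apply: (le_trans (ler_normD _ _)); apply: lerD => //.
rewrite [(C1 + C2) * N]mulrDl [leRHS]mulrDl addrC.
by apply: (le_trans (ler_normD _ _)); apply: lerD.
Qed.

End TrapezoidError.

(** * The choice of T and the final estimate *)

Lemma L2rho_norm2_ge0 (R : realType) (u : R -> R) : 0 <= L2rho_norm2 u.
Proof.
apply: fine_ge0; apply: integral_ge0 => x _; rewrite lee_fin.
by apply: mulr_ge0; [exact: sqr_ge0|exact: rho_ge0].
Qed.

Lemma sqrt_L2rho_norm2_le_H_norm (R : realType) (alpha i : nat) (d : nat -> R -> R) :
  (i <= alpha)%N -> Num.sqrt (L2rho_norm2 (d i)) <= H_norm alpha d.
Proof.
move=> ia; rewrite /H_norm ler_sqrt; last first.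
  by apply: sumr_ge0 => j _; exact: L2rho_norm2_ge0.
rewrite (bigD1 (Ordinal (ia : (i < alpha.+1)%N)))//= lerDl.
by apply: sumr_ge0 => j _; exact: L2rho_norm2_ge0.
Qed.

Theorem theorem4p5 (R : realType) (eps : R) (alpha : nat) :
  1 / 2 < eps -> eps < 1 -> (1 <= alpha)%N ->
  exists C : R, forall (f : R -> R) (d : nat -> R -> R) (n : nat),
    in_H alpha f d -> (2 <= n)%N ->
    let T := Num.sqrt (2 / (1 - eps) * alpha%:R * ln n%:R) in
    `| Igauss f - trap n T (fun x => f x * rho x) |
      <= C * H_norm alpha d * (ln n%:R `^ (alpha%:R / 2 + 1 / 4)) / n%:R ^+ alpha.
Proof.
move=> e0 e1 al1.
pose K0 : R := 2 / (1 - eps) * alpha%:R.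
have K00 : 0 < K0 by rewrite mulr_gt0 ?ltr0n// divr_gt0// subr_gt0.
(* The mesh is 2 sqrt (K0 ln n) / n, and ln n <= n makes [h0] an upper bound for every n. *)
pose h0 := 2 * Num.sqrt K0.
have h00 : 0 <= h0 by rewrite mulr_ge0// sqrtr_ge0.
have [C C0 HC] := trapezoid_error e0 e1 al1 h00.
pose ex : R := alpha%:R / 2 + 1 / 4.
have l2 : 0 < ln 2 :> R by rewrite ln_gt0// ltr1n.
(* h^alpha carries the power alpha/2 of ln n and the tail term carries none; since ln n >= ln 2,
   dividing by [q1] and [q2] supplies the missing powers. *)
pose q1 : R := ln 2 `^ (1 / 4); pose q2 : R := ln 2 `^ ex.
have q10 : 0 < q1 by exact: powR_gt0.
have q20 : 0 < q2 by exact: powR_gt0.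
exists (C * (h0 ^+ alpha / q1 + expR (4 * alpha%:R) / q2)) => f d n Hf n2.
set T := Num.sqrt _; cbv zeta.
pose L : R := ln n%:R.
have n0 : 0 < n%:R :> R by rewrite ltr0n (ltn_trans _ n2).
have nr2 : 2 <= n%:R :> R by rewrite ler_nat.
have lL : ln 2 <= L by rewrite ler_ln ?posrE.
have L0 : 0 < L by exact: lt_le_trans lL.
have Ln : L <= n%:R by exact/ltW/ln_sublinear.
pose h := 2 * T / n%:R.
have T2 : T ^+ 2 = K0 * L by rewrite sqr_sqrtr// mulr_ge0// ltW.
have T0 : 0 < T by rewrite sqrtr_gt0 mulr_gt0.
have TE : T = Num.sqrt K0 * Num.sqrt L by rewrite /T -/K0 -/L sqrtrM// ltW.
have hp : 0 < h by rewrite divr_gt0// mulr_gt0.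
have Tn : 2 * T = h * n%:R by rewrite divfK// gt_eqF.
have hT : h <= T.
  by rewrite /h ler_pdivrMr// mulrC ler_pM2l.
have hE : h = h0 * (Num.sqrt L / n%:R) by rewrite /h TE /h0; ring.
have hh0 : h <= h0.
  rewrite hE ler_piMr// ler_pdivrMr// mul1r.
  rewrite -[leRHS](ger0_norm (ltW n0)) -sqrtr_sqr ler_sqrt ?sqr_ge0//.
  by apply: (le_trans Ln); rewrite expr2 ler_peMl ?ltW//; lra.
have := HC f d n (H_norm alpha d) h T Hf
  (fun i => @sqrt_L2rho_norm2_le_H_norm _ alpha i d) hp hh0 Tn hT.
rewrite /trap -/h => /le_trans; apply.
have N0 : 0 <= H_norm alpha d by exact: sqrtr_ge0.
have na : 0 < n%:R ^+ alpha :> R by rewrite exprn_gt0.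
rewrite -/L -/ex.
have Lex : L `^ ex = L `^ (alpha%:R / 2) * L `^ (1 / 4).
  by rewrite powRD// gt_eqF// implybT.
have q1L : q1 <= L `^ (1 / 4).
  by apply: ge0_ler_powR => //; rewrite nnegrE ltW.
have q2L : q2 <= L `^ ex.
  apply: ge0_ler_powR => //; rewrite ?nnegrE 1?ltW//.
  by rewrite ltr_wpDl// divr_ge0.
have b1 : h ^+ alpha <= h0 ^+ alpha / q1 * (L `^ ex / n%:R ^+ alpha).
  rewrite hE exprMn -[leRHS]mulrA; apply: ler_wpM2l; first exact: exprn_ge0.
  rewrite expr_div_n mulrA; apply: ler_wpM2r; first by rewrite invr_ge0 ltW.
  have -> : Num.sqrt L ^+ alpha = L `^ (alpha%:R / 2).
    by rewrite -powR12_sqrt ?ltW// -powR_mulrn ?powR_ge0// -powRrM mulrC.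
  rewrite Lex mulrCA ler_peMr ?powR_ge0//.
  by rewrite -ler_pdivrMl ?invr_gt0// invrK mulr1.
have b2 : expR (- ((1 - eps) / 2 * (T - h) ^+ 2)) <=
    expR (4 * alpha%:R) / q2 * (L `^ ex / n%:R ^+ alpha).
  have nE : (n%:R ^+ alpha)^-1 = expR (- (alpha%:R * L)).
    by rewrite expRN expRM_natl /L lnK ?posrE.
  have -> : expR (4 * alpha%:R) / q2 * (L `^ ex / n%:R ^+ alpha) =
      expR (4 * alpha%:R) * expR (- (alpha%:R * L)) * (q2^-1 * L `^ ex).
    by rewrite nE; ring.
  apply: (@le_trans _ _ (expR (4 * alpha%:R) * expR (- (alpha%:R * L)))); last first.
    rewrite ler_peMr ?mulr_ge0 ?expR_ge0//.
    by rewrite -ler_pdivrMl ?invr_gt0// invrK mulr1.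
  rewrite -expRD ler_expR.
  (* Replacing T by T - h = T (1 - 2/n) costs at most 4 alpha (ln n) / n <= 4 alpha in the exponent,
     whence the factor exp (4 alpha). *)
  have -> : (1 - eps) / 2 * (T - h) ^+ 2 = alpha%:R * L * (1 - 2 / n%:R) ^+ 2.
    have -> : (T - h) ^+ 2 = T ^+ 2 * (1 - 2 / n%:R) ^+ 2.
      by rewrite /h; field; rewrite gt_eqF.
    by rewrite T2 /K0; field; rewrite !gt_eqF// subr_gt0.
  have Ly : L / n%:R <= 1 by rewrite ler_pdivrMr// mul1r.
  have a0 : 0 <= alpha%:R :> R by [].
  have -> : alpha%:R * L * (1 - 2 / n%:R) ^+ 2 = alpha%:R * L -
      4 * alpha%:R * (L / n%:R) + alpha%:R * L * (2 / n%:R) ^+ 2.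
    by field; rewrite gt_eqF.
  have : 4 * alpha%:R * (L / n%:R) <= 4 * alpha%:R by rewrite ler_piMr// mulr_ge0.
  have : 0 <= alpha%:R * L * (2 / n%:R) ^+ 2.
    by apply: mulr_ge0; [rewrite mulr_ge0// ltW|exact: sqr_ge0].
  lra.
have -> : C * (h0 ^+ alpha / q1 + expR (4 * alpha%:R) / q2) * H_norm alpha d *
    L `^ ex / n%:R ^+ alpha = C * H_norm alpha d *
    (h0 ^+ alpha / q1 * (L `^ ex / n%:R ^+ alpha) +
     expR (4 * alpha%:R) / q2 * (L `^ ex / n%:R ^+ alpha)) by ring.
by apply: ler_wpM2l; [exact: mulr_ge0|exact: lerD].
Qed.
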